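(* Let $n$ be the number of bins, let $b \geq n$ be the batch size, and let $p=(p_1,\dots,p_n)$ be a probability vector satisfying condition $\mathcal{C}_1$ for a constant $\delta \in (0,1)$ and some (not necessarily constant) $\epsilon \in (0,1)$, and condition $\mathcal{C}_2$ for some constant $C>1$. Let the weight distribution $W$ satisfy $\mathbb{E}[W]=1$, $\mathbb{E}[e^{\lambda W}]<\infty$ for a constant $\lambda>0$, and let $S \geq 1$ be a constant such that $\mathbb{E}[e^{\alpha \kappa W}] \leq 1+\alpha\kappa + S\alpha^2\kappa^2$ for all $\alpha \in (0,\min(\lambda/2,1))$ and all $\kappa\in[-1,1]$. Consider the batched allocation process with weights with parameters $b$, $p$, $W$. Then there exists a constant $k := k(\delta, C, S)>0$ such that for every $m \geq 0$ that is a multiple of $b$, \[ \Pr\Big[\max_{i\in[n]} |y_i^m| \leq k \cdot \frac{1}{\epsilon}\cdot \frac{b}{n}\cdot \log n\Big] \geq 1-n^{-2}. \]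
   Context: Batched allocation with weights: there are $n$ bins, all initially of load $0$. Balls $t=1,2,\dots$ have weights $w^t$ drawn independently from a distribution $W$ on $[0,\infty)$. Let $x_i^t$ be the total weight in bin $i$ after $t$ balls, $W^t=\sum_{s\le t} w^s$, $\tilde x_i^t = x_i^t - W^t/n$, and let $y^t$ be $\tilde x^t$ sorted decreasingly ($y_1^t\ge \dots \ge y_n^t$). For each $t$ that is a multiple of $b$ (i.e. $t=0,b,2b,\dots$): sample $b$ indices $i_1,\dots,i_b\in[n]$ independently according to $p$ and $b$ weights $w^{t+1},\dots,w^{t+b}$ independently from $W$; set $z_i^{t+b}=y_i^t+\sum_{j=1}^b w^{t+j}\mathbf{1}_{i_j=i}-\frac1n\sum_{j=1}^b w^{t+j}$ for each $i$, and let $y^{t+b}$ be $z^{t+b}$ sorted decreasingly. Thus $p_i$ is the probability that a ball of the batch goes to the bin that was the $i$-th most loaded at the start of the batch (load information is only updated at the start of each batch). Condition $\mathcal{C}_1$ (with $\delta,\epsilon$): for all $1\le k\le \delta n$, $\sum_{i=1}^k p_i \le (1-\epsilon)\frac{k}{n}$, and for all $\delta n+1\le k\le n$, $\sum_{i=k}^n p_i \ge \big(1+\epsilon\frac{\delta}{1-\delta}\big)\frac{n-k+1}{n}$. Condition $\mathcal{C}_2$ (with $C$): $\max_{i\in[n]} p_i \le C/n$.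
   Formalization: The constant k is allowed to depend on λ as well as on δ, C and S; a k depending only on δ, C, S is impossible, since S ≥ 1 alone does not control 1/λ (e.g. W = 1/λ with probability λ², else 1/(1+λ), with S = 2 and n = b ≈ λ⁻²). *)

(* Defs.v *)
From HB Require Import structures.
From mathcomp Require Import all_boot all_order all_algebra.
From mathcomp Require Import all_classical all_reals all_analysis.

Set Implicit Arguments.
Unset Strict Implicit.
Unset Printing Implicit Defensive.

Import Order.TTheory GRing.Theory Num.Theory.
Import numFieldNormedType.Exports.

Local Open Scope classical_set_scope.
Local Open Scope ring_scope.

(* Bins, ranks and balls are numbered from 0: the rank i : 'I_n stands for the
   rank i + 1 of the literature, and ball t : nat for the ball t + 1. *)

Definition prob_vector (R : realType) (n : nat) (p : 'I_n -> R) : Prop :=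
  (forall i, 0 <= p i) /\ \sum_(i < n) p i = 1.

(* k is a 1-based rank, so the suffix i >= k of 1-based ranks reads k <= i.+1. *)
Definition condC1 (R : realType) (n : nat) (delta eps : R) (p : 'I_n -> R) :
    Prop :=
  (forall k : nat, (1 <= k)%N -> k%:R <= delta * n%:R ->
     \sum_(i < n | (i < k)%N) p i <= (1 - eps) * (k%:R / n%:R)) /\
  (forall k : nat, delta * n%:R + 1 <= k%:R -> (k <= n)%N ->
     (1 + eps * (delta / (1 - delta))) * ((n%:R - k%:R + 1) / n%:R)
       <= \sum_(i < n | (k <= i.+1)%N) p i).

Definition condC2 (R : realType) (n : nat) (C : R) (p : 'I_n -> R) : Prop :=
  \big[Num.max/0]_(i < n) p i <= C / n%:R.

Definition weight_law (R : realType) (lambda S : R)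
    (W : probability R R) : Prop :=
  [/\ W [set x : R | 0 <= x] = 1%E,
      ('E_W[fun x => x] = 1)%E,
      ('E_W[fun x => expR (lambda * x)] < +oo)%E
    & forall alpha kappa : R,
        0 < alpha -> alpha < Num.min (lambda / 2) 1 ->
        -1 <= kappa -> kappa <= 1 ->
        ('E_W[fun x => expR (alpha * kappa * x)]
           <= (1 + alpha * kappa + S * alpha ^+ 2 * kappa ^+ 2)%:E)%E].

Definition mutually_independent (d : measure_display) (T : measurableType d)
    (R : realType) (P : probability T R) (I : choiceType)
    (F : I -> set (set T)) : Prop :=
  forall (J : seq I) (E : I -> set T), uniq J ->
    (forall i, i \in J -> F i (E i)) ->
    P (\bigcap_(i in [set` J]) E i) = \big[*%E/1%E]_(i <- J) P (E i).

(* w t and a t are the weight of ball t and the rank it is sent to. *)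
Record ball_samples (d : measure_display) (T : measurableType d)
    (R : realType) (P : probability T R) (n : nat) (p : 'I_n -> R)
    (W : probability R R)
    (w : nat -> {RV P >-> R}) (a : nat -> T -> 'I_n) : Prop := {
  weight_distr : forall t (A : set R), measurable A ->
    P (w t @^-1` A) = W A ;
  rank_measurable : forall t i, measurable (a t @^-1` [set i]) ;
  rank_distr : forall t i, P (a t @^-1` [set i]) = (p i)%:E ;
  samples_independent : mutually_independent P
    (fun s : nat + nat => match s with
     | inl t => [set w t @^-1` A | A in measurable]
     | inr t => [set a t @^-1` B | B in [set: set 'I_n]]
     end) }.

(* batch_loads b w a r is y^(r b), the decreasingly sorted vector of normalized
   loads after r batches, i.e. after r * b balls. *)
Fixpoint batch_loads (R : realType) (n b : nat) (w : nat -> R)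
    (a : nat -> 'I_n) (r : nat) : n.-tuple R :=
  match r with
  | 0 => [tuple 0 | i < n]
  | r'.+1 =>
    let y := batch_loads b w a r' in
    let t := (r' * b)%N in
    let z (i : 'I_n) :=
      tnth y i + \sum_(j < b) w (t + j)%N * (a (t + j)%N == i)%:R
      - n%:R^-1 * \sum_(j < b) w (t + j)%N in
    sort_tuple >=%R [tuple z i | i < n]
  end.

Definition max_abs_load (R : realType) (n : nat) (y : n.-tuple R) : R :=
  \big[Num.max/0]_(i < n) `|tnth y i|.

(* Main.v *)
(** The proof follows the hyperbolic cosine potential
      Gamma(y) = sum_i (exp (alpha y_i) + exp (- alpha y_i)),
    with alpha of order eps n / b, so that beta := alpha b / n is of order eps.
    Given the loads y at the start of a batch, the b balls are independent, so
    the expected values of exp (alpha y_i) and exp (- alpha y_i) are multiplied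
    by b-th powers, at most 1 +- beta (n p_i - 1) + O(beta^2).
    By Abel summation, C1 lets us replace n p - 1 by eps times the extremal
    two-valued vector r (-1 on the first delta n ranks, delta / (1 - delta) on
    the others). For that vector, sum_i r_i (exp x_i - exp (- x_i)) is at most
    - c Gamma + c' n whenever x is sorted and sums to 0. Hence the expectation
    of Gamma contracts up to an additive term and stays O(n) at all times, and
    Markov's inequality at level O(n^3) gives the bound. *)

From HB Require Import structures.
Require Import Defs.
From mathcomp Require Import all_boot all_order all_algebra.
From mathcomp Require Import all_classical all_reals all_analysis.
From mathcomp Require Import measurable_realfun ring lra.
Import Order.TTheory GRing.Theory Num.Theory.
Local Open Scope classical_set_scope.
Local Open Scope ring_scope.

(** * Independence of the past and of the next sample *)

Section independence.
Context (d : measure_display) (T : measurableType d) (R : realType)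
  (P : probability T R).

(** The joint law of [X] and [Y] agrees with the product of their laws on rectangles, hence
    everywhere; Tonelli then factors the integral. *)
Lemma ge0_integralM_indep_comp (d1 d2 : measure_display)
    (T1 : measurableType d1) (T2 : measurableType d2)
    (X : {mfun T >-> T1}) (Y : {mfun T >-> T2}) (f : T1 -> R) (g : T2 -> R) :
  measurable_fun setT f -> measurable_fun setT g ->
  (forall x, 0 <= f x) -> (forall y, 0 <= g y) ->
  (forall A B, measurable A -> measurable B ->
     P (X @^-1` A `&` Y @^-1` B) = (P (X @^-1` A) * P (Y @^-1` B))%E) ->
  (\int[P]_t (f (X t) * g (Y t))%:E
    = \int[P]_t (f (X t))%:E * \int[P]_t (g (Y t))%:E)%E.
Proof.
move=> mf mg f0 g0 XY.
pose h := fun t => (X t, Y t).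
have mh : measurable_fun setT h by apply: measurable_fun_pair.
pose hM := HB.pack_for {mfun T >-> (T1 * T2)%type} h
  (isMeasurableFun.Build _ _ _ _ _ mh).
have joint (Z : set (T1 * T2)) : measurable Z ->
    (distribution P X \x distribution P Y)%E Z = distribution P hM Z.
  by move=> mZ; exact: product_measure_unique.
pose k (z : T1 * T2) : \bar R := (f z.1 * g z.2)%:E.
have mk : measurable_fun setT k.
  by apply/measurable_EFinP/measurable_funM; apply: measurableT_comp.
have k0 z : (0 <= k z)%E by rewrite lee_fin mulr_ge0.
transitivity (\int[distribution P hM]_z k z)%E.
  by rewrite /distribution ge0_integral_pushforward.
rewrite (eq_measure_integral (distribution P X \x distribution P Y)%E); last first.
  by move=> A mA _; symmetry; exact: joint.
rewrite fubini_tonelli1// /fubini_F /k /=.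
under eq_integral => x _.
  under eq_integral do rewrite EFinM.
  rewrite ge0_integralZl_EFin//; last 2 first.
  - by move=> y _; rewrite lee_fin.
  - exact/measurable_EFinP.
  over.
rewrite ge0_integralZr//; last 3 first.
- exact/measurable_EFinP.
- by move=> x _; rewrite lee_fin.
- by apply: integral_ge0 => y _; rewrite lee_fin.
rewrite /distribution !ge0_integral_pushforward//.
- exact/measurable_EFinP.
- by move=> y _; rewrite lee_fin.
- exact/measurable_EFinP.
- by move=> y _; rewrite lee_fin.
Qed.

Lemma ge0_integralM_indep (X Y : T -> R) :
  measurable_fun setT X -> measurable_fun setT Y ->
  (forall t, 0 <= X t) -> (forall t, 0 <= Y t) ->
  (forall A B : set R, measurable A -> measurable B ->
     P (X @^-1` A `&` Y @^-1` B) = (P (X @^-1` A) * P (Y @^-1` B))%E) ->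
  (\int[P]_t (X t * Y t)%:E = \int[P]_t (X t)%:E * \int[P]_t (Y t)%:E)%E.
Proof.
move=> mX mY X0 Y0 XY.
pose XM := HB.pack_for {mfun T >-> R} X (isMeasurableFun.Build _ _ _ _ _ mX).
pose YM := HB.pack_for {mfun T >-> R} Y (isMeasurableFun.Build _ _ _ _ _ mY).
(* The composition lemma wants functions that are nonnegative on the whole line, so [X] and [Y] are
   replaced by their absolute values. *)
transitivity (\int[P]_t (`|XM t| * `|YM t|)%:E)%E.
  by apply: eq_integral => t _ /=; rewrite !ger0_norm.
rewrite (@ge0_integralM_indep_comp _ _ R R XM YM Num.norm Num.norm)//.
by congr (_ * _)%E; apply: eq_integral => t _ /=; rewrite ger0_norm.
Qed.

(** The restriction of [P] to [B] and the multiple of [P] by [P B] are finite measures that agree on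
    the pi-system [G], hence on the sigma-algebra it generates. *)
Lemma indep_g_sigma_algebra (G : set (set T)) (B : set T) :
  G `<=` measurable -> G setT -> setI_closed G -> measurable B ->
  (forall A, G A -> P (A `&` B) = (P A * P B)%E) ->
  forall A, <<s G >> A -> P (A `&` B) = (P A * P B)%E.
Proof.
move=> Gm GT GI mB GB A sA.
have PBfin : P B \is a fin_num by exact: fin_num_measure.
have PB0 : 0 <= fine (P B) by apply: fine_ge0.
have := @g_sigma_algebra_measure_unique _ R T G Gm (fun=> setT) (fun=> GT)
  _ (mrestr P mB) (mscale (NngNum PB0) P) GI _ _ A sA.
have scaleE X : (P X * P B = mscale (NngNum PB0) P X)%E.
  by rewrite /mscale/= fineK// muleC.
rewrite scaleE; apply.
- by apply/seteqP; split => // x _; exists 0%N.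
- by move=> C GC; transitivity (P C * P B)%E; [exact: GB|exact: scaleE].
- move=> _; apply: le_lt_trans (ltry 1).
  exact: (probability_le1 P (measurableI _ _ measurableT mB)).
Qed.

End independence.

(** When each [F i] is closed under intersection, this is a pi-system generating the joint
    sigma-algebra of the families in [K]. Its members are the finite intersections that mutual
    independence speaks of. *)
Definition joint_cylinders (T : Type) (I : choiceType) (F : I -> set (set T))
    (K : set I) : set (set T) :=
  [set A | exists (J : seq I) (E : I -> set T),
    [/\ uniq J, (forall i, i \in J -> K i /\ F i (E i))
      & A = \bigcap_(i in [set` J]) E i]].

Section joint_cylinders.
Context (d : measure_display) (T : measurableType d) (R : realType)
  (P : probability T R) (I : choiceType) (F : I -> set (set T)).
Hypothesis Fm : forall i, F i `<=` measurable.
Hypothesis FT : forall i, F i setT.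
Hypothesis FI : forall i, setI_closed (F i).

Lemma joint_cylindersT (K : set I) : joint_cylinders T I F K setT.
Proof.
by exists [::], (fun=> setT); split => //; apply/seteqP; split.
Qed.

Lemma sub_joint_cylinders (K : set I) i : K i -> F i `<=` joint_cylinders T I F K.
Proof.
move=> Ki A FA; exists [:: i], (fun=> A); split => //.
  by move=> j; rewrite inE => /eqP ->.
apply/seteqP; split => [x Ax j _ //|x]; apply; exact: mem_head.
Qed.

Lemma joint_cylindersI (K : set I) : setI_closed (joint_cylinders T I F K).
Proof.
move=> A B [J1 [E1 [u1 H1 ->]]] [J2 [E2 [u2 H2 ->]]].
(* An index missing from one list is padded with [setT], so that both events range over the merged
   list. *)
exists (undup (J1 ++ J2)), (fun i => (if i \in J1 then E1 i else setT) `&`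
                                    (if i \in J2 then E2 i else setT)).
split; first exact: undup_uniq.
  move=> i; rewrite mem_undup mem_cat => iJ; split.
    by case/orP: iJ => [/H1[]|/H2[]].
  apply: FI; case: ifPn => iJ' //; by [case: (H1 _ iJ')|case: (H2 _ iJ')].
apply/seteqP; split => [x [x1 x2] i iJ|x xJ].
  by split; case: ifPn => // iJ'; [exact: x1|exact: x2].
split=> i iJ.
  have /xJ[] : [set` undup (J1 ++ J2)] i by rewrite /= mem_undup mem_cat iJ.
  by rewrite iJ.
have /xJ[] : [set` undup (J1 ++ J2)] i by rewrite /= mem_undup mem_cat iJ orbT.
by rewrite iJ.
Qed.

Lemma joint_cylinders_measurable (K : set I) :
  joint_cylinders T I F K `<=` measurable.
Proof.
move=> A [J [E [uJ JE ->]]]; rewrite bigcap_seq big_seq.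
by apply: bigsetI_measurable => i iJ; apply: (Fm i); case: (JE i iJ).
Qed.

(** Mutual independence is applied to [J] and to [s :: J]; the second product has just the extra
    factor [P B]. *)
Lemma joint_cylinders_indep (K : set I) s (A B : set T) :
  mutually_independent P F -> ~ K s -> joint_cylinders T I F K A -> F s B ->
  P (A `&` B) = (P A * P B)%E.
Proof.
move=> indF Ks [J [E [uJ JE ->]]] FB.
have sJ : s \notin J by apply/negP => /JE[].
pose E' i := if i == s then B else E i.
have E'J i : i \in J -> E' i = E i.
  by move=> iJ; rewrite /E'; case: eqP => // si; rewrite -si iJ in sJ.
have E's : E' s = B by rewrite /E' eqxx.
have := indF (s :: J) E'.
rewrite /= sJ uJ big_cons E's => indE.
transitivity (P (\bigcap_(i in [set` s :: J]) E' i)).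
  congr (P _); apply/seteqP; split => [x [xJ xB] i|x xJ].
    rewrite /= inE /E'; case: eqP => //= _ iJ; exact: xJ.
  split=> [i iJ|]; last first.
    by have := xJ s; rewrite E's; apply => /=; rewrite mem_head.
  by rewrite -E'J//; apply: xJ; rewrite /= inE iJ orbT.
rewrite indE//.
  rewrite muleC; congr (_ * _)%E; rewrite (indF J E)//.
    rewrite big_seq [RHS]big_seq; apply: eq_bigr => i iJ.
    by rewrite E'J.
  by move=> i /JE[].
move=> i; rewrite inE /E'; case: eqP => [->//|_ /= /JE[]//].
Qed.

Lemma measurable_fun_joint_cylinders (K : set I) (f : T -> R) :
  measurable_fun (setT : set (g_sigma_algebraType (joint_cylinders T I F K))) f ->
  measurable_fun (setT : set T) f.
Proof.
move=> mf _ B mB.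
have : <<s joint_cylinders T I F K >> (setT `&` f @^-1` B) by exact: mf.
apply: smallest_sub; last exact: joint_cylinders_measurable.
by split => // [A mA|A mA]; [exact: measurableD|exact: bigcupT_measurable].
Qed.

(** The form in which independence is used below: [f] is determined by the samples in [K], and [Y]
    by one sample outside [K]. *)
Lemma ge0_integralM_joint_cylinders (K : set I) s (f Y : T -> R) :
  mutually_independent P F -> ~ K s ->
  measurable_fun (setT : set (g_sigma_algebraType (joint_cylinders T I F K))) f ->
  (forall B, measurable B -> F s (Y @^-1` B)) ->
  (forall t, 0 <= f t) -> (forall t, 0 <= Y t) ->
  (\int[P]_t (f t * Y t)%:E = \int[P]_t (f t)%:E * \int[P]_t (Y t)%:E)%E.
Proof.
move=> indF Ks mf FY f0 Y0.
apply: ge0_integralM_indep => //.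
- exact: (measurable_fun_joint_cylinders K).
- by move=> _ B mB; rewrite setTI; apply: (Fm s); exact: FY.
- move=> A B mA mB.
  apply: (@indep_g_sigma_algebra _ _ _ _ (joint_cylinders T I F K)).
  + exact: joint_cylinders_measurable.
  + exact: joint_cylindersT.
  + exact: joint_cylindersI.
  + by apply: (Fm s); exact: FY.
  + by move=> C HC; apply: (joint_cylinders_indep K s) => //; exact: FY.
  + have : <<s joint_cylinders T I F K >> (setT `&` f @^-1` A) by exact: mf.
    by rewrite setTI.
Qed.

End joint_cylinders.

(** * Drift of the potential for two-valued rank weights *)

Section exponential_drift.
Context (R : realType).

(** With s = v - x, multiplying by exp v turns the right side into exp v - exp x + exp (- x). For s
    <= 2 v + 2 the bound 1 - exp (- s) >= s / (1 + s) suffices; beyond that, the last exponential is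
    at least 1 + s - 2 v. *)
Lemma expR_gap_ge (v s : R) : 0 <= v -> 0 <= s ->
  s / (3 + 2 * v) <= 1 - expR (- s) + expR (s - 2 * v).
Proof.
move=> v0 s0; rewrite ler_pdivrMr; last by lra.
have e1 : (1 + s) * expR (- s) <= 1.
  by rewrite expRN -ler_pdivlMr ?invr_gt0 ?expR_gt0// invrK mul1r expR_ge1Dx.
have e0 : 0 < expR (- s) by exact: expR_gt0.
have f0 : 0 < expR (s - 2 * v) by exact: expR_gt0.
have f1 : 1 + (s - 2 * v) <= expR (s - 2 * v) by exact: expR_ge1Dx.
have e2 : expR (- s) <= 1 by rewrite -expR0 ler_expR; lra.
have [sv|sv] := leP s (2 * v + 2); nra.
Qed.

(** From exp (- x) >= 1 - x follows exp x <= 1 / (1 - x), and (1 - x) (1 + x + 2 x^2) = 1 + x^2 (1 -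
    2 x) >= 1 on this range. *)
Lemma expR_le_quadratic (x : R) : x <= 1 / 2 -> expR x <= 1 + x + 2 * x ^+ 2.
Proof.
move=> x1.
have e1 : 1 - x <= expR (- x) by have := expR_ge1Dx (- x).
have e0 : 0 < expR x by exact: expR_gt0.
have e : expR x * expR (- x) = 1 by rewrite expRN divff// gt_eqF.
have : expR x * (1 - x) <= expR x * expR (- x) by rewrite ler_wpM2l// ltW.
rewrite e; nra.
Qed.

Let cosh2 (x : R) := expR x + expR (- x).
Let sinh2 (x : R) := expR x - expR (- x).

Let drift_sinh_ge0 (I : finType) (i0 : I) (r x : I -> R) (kap M : R) :
  0 < kap -> kap <= M -> 0 <= x i0 ->
  \sum_i r i = 0 -> \sum_i x i = 0 -> (forall i, `|r i| <= M) ->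
  (forall i, i != i0 -> (r i <= - kap /\ x i0 <= x i)
                     \/ (kap <= r i /\ x i <= x i0)) ->
  \sum_i r i * sinh2 (x i)
    <= - (kap / 6) * \sum_i cosh2 (x i) + (kap + M) * #|I|%:R.
Proof.
move=> kap0 kapM; set v := x i0 => v0 r0 sx0 rM rx.
have ev : 1 <= expR v by rewrite -expR0 ler_expR.
(* As r sums to 0, exp (x i) may be replaced by its excess over exp v, so that
   the drift is at most - kap * sum G + O(#|I|). Since G i is at least
   exp v * (v - x i) / (3 + 2 v) and the v - x i sum to v * #|I|, sum G also
   dominates the level exp v, hence the whole of cosh2. *)
pose G i := if v <= x i then expR (x i) - expR v
            else expR v - expR (x i) + expR (- x i).
have Gx i : expR v * (v - x i) / (3 + 2 * v) <= G i.
  rewrite /G; case: ifPn => vx.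
    apply: (@le_trans _ _ 0); last by rewrite subr_ge0 ler_expR.
    rewrite pmulr_lle0 ?invr_gt0; last by lra.
    by rewrite pmulr_rle0 ?expR_gt0// subr_le0.
  have s0 : 0 <= v - x i by rewrite -ltNge in vx; lra.
  have := @expR_gap_ge v (v - x i) v0 s0.
  rewrite -(ler_pM2l (expR_gt0 v)) mulrA => /le_trans; apply.
  rewrite mulrDr mulrBr mulr1 -!expRD.
  by rewrite le_eqVlt; apply/orP; left; apply/eqP; congr (_ - expR _ + expR _); ring.
have G0 i : 0 <= G i.
  rewrite /G; case: ifPn => vx; first by rewrite subr_ge0 ler_expR.
  have := expR_gt0 (- x i).
  have : expR (x i) <= expR v by rewrite ler_expR; rewrite -ltNge in vx; lra.
  lra.
have coshG i : cosh2 (x i) <= G i + (expR v + 1).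
  rewrite /cosh2 /G; case: ifPn => vx.
    have : expR (- x i) <= 1 by rewrite -expR0 ler_expR; lra.
    lra.
  have : expR (x i) <= expR v by rewrite ler_expR; rewrite -ltNge in vx; lra.
  lra.
(* For [x i < v] the bracket equals [- G i]; otherwise it equals [G i] minus exp (- x i) <= 1, and
   that remainder costs at most [M]. *)
have sinhG i : r i * (sinh2 (x i) - expR v) <= - kap * G i + M.
  have [rM1 rM2] : - M <= r i /\ r i <= M by apply/andP; rewrite -ler_norml.
  have ex0 := expR_gt0 (- x i).
  rewrite /sinh2 /G; case: (eqVneq i i0) => [->|/rx[[ri xi]|[ri xi]]].
  - rewrite -/v lexx.
    have : expR (- v) <= 1 by rewrite -expR0 ler_expR; lra.
    have := expR_gt0 (- v).
    have : - M <= r i0 /\ r i0 <= M by apply/andP; rewrite -ler_norml.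
    by nra.
  - rewrite xi.
    have : expR (- x i) <= 1 by rewrite -expR0 ler_expR; lra.
    have : expR v <= expR (x i) by rewrite ler_expR.
    by nra.
  - case: ifPn => vx.
      have -> : x i = v by apply/eqP; rewrite eq_le xi vx.
      have : expR (- v) <= 1 by rewrite -expR0 ler_expR; lra.
      have := expR_gt0 (- v).
      by nra.
    have : expR (x i) <= expR v by rewrite ler_expR; rewrite -ltNge in vx; lra.
    by nra.
set N : R := #|I|%:R.
have N0 : 0 <= N by rewrite ler0n.
have cstN c : \sum_(i in I) c = N * c :> R by rewrite sumr_const -mulr_natl.
(* For v > 1 the factor v / (3 + 2 v) of the summed lower bounds is at least 1 / 5; for v <= 1, exp
   v <= 5 and the term [5 * N] suffices. *)
have GN : expR v * N <= 5 * \sum_i G i + 5 * N.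
  have SG0 : 0 <= \sum_i G i by apply: sumr_ge0.
  have [v1|v1] := leP v 1.
    have : expR v <= 5.
      have : expR v <= expR 1 by rewrite ler_expR.
      have : expR (1 / 2) <= 1 + 1 / 2 + 2 * (1 / 2) ^+ 2 :> R.
        exact: expR_le_quadratic.
      have -> : expR 1 = expR (1 / 2) * expR (1 / 2) :> R.
        by rewrite -expRD; congr expR; lra.
      have := expR_gt0 (1 / 2 : R). nra.
    nra.
  have : \sum_i (expR v * (v - x i) / (3 + 2 * v)) <= \sum_i G i by apply: ler_sum.
  rewrite -mulr_suml -mulr_sumr sumrB cstN sx0 subr0.
  rewrite ler_pdivrMr; last by lra.
  have : 0 <= expR v * N by rewrite mulr_ge0// expR_ge0.
  nra.
(* With [GN], the sum of [cosh2] is at most 6 times the sum of [G] plus 6 [N]: hence the rate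
   [kap / 6] and the added [kap] in the constant. *)
have SC : \sum_i cosh2 (x i) <= \sum_i G i + N * (expR v + 1).
  by rewrite -cstN -big_split/=; apply: ler_sum.
have SS : \sum_i r i * sinh2 (x i) <= - kap * \sum_i G i + N * M.
  rewrite mulr_sumr -cstN -big_split/=.
  have -> : \sum_i r i * sinh2 (x i) = \sum_i r i * (sinh2 (x i) - expR v).
    under [RHS]eq_bigr do rewrite mulrBr.
    by rewrite sumrB -mulr_suml r0 mul0r subr0.
  by apply: ler_sum.
nra.
Qed.

(** Negating both [r] and [x] preserves hypotheses and conclusion, which reduces to [0 <= x i0]. The
    sign condition spares [i0] because the extremal weights may take an intermediate value at the
    rank where delta n falls. *)
Lemma drift_sinh (I : finType) (i0 : I) (r x : I -> R) (kap M : R) :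
  0 < kap -> kap <= M ->
  \sum_i r i = 0 -> \sum_i x i = 0 -> (forall i, `|r i| <= M) ->
  (forall i, i != i0 -> (r i <= - kap /\ x i0 <= x i)
                     \/ (kap <= r i /\ x i <= x i0)) ->
  \sum_i r i * (expR (x i) - expR (- x i))
    <= - (kap / 6) * \sum_i (expR (x i) + expR (- x i)) + (kap + M) * #|I|%:R.
Proof.
move=> kap0 kapM r0 x0 rM rx.
have [v0|v0] := leP 0 (x i0); first exact: (@drift_sinh_ge0 I i0 r x kap M).
have := @drift_sinh_ge0 I i0 (fun i => - r i) (fun i => - x i) kap M kap0 kapM.
rewrite /sinh2 /cosh2 oppr_ge0 (ltW v0) !sumrN r0 x0 oppr0.
under eq_bigr do rewrite opprK mulNr -mulrN opprB.
under [X in _ * X + _]eq_bigr do rewrite opprK addrC.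
apply => // i.
  by rewrite normrN.
by move=> /rx[[ri xi]|[ri xi]]; [right|left]; split; lra.
Qed.

End exponential_drift.

(** * Measurability of the loads *)

Lemma natr_eq_indic (R : realType) (T : Type) (I : eqType) (f : T -> I) (i : I) :
  (fun x => (f x == i)%:R) = \1_(f @^-1` [set i]) :> (T -> R).
Proof.
apply/funext => x; rewrite indicE; congr (_%:R); congr nat_of_bool.
by apply/eqP/idP => [?|/set_mem//]; exact: mem_set.
Qed.

(** Turns an order statistic into a count, which does not depend on the order and can be evaluated
    before sorting. *)
Lemma sorted_ge_nthP (R : realType) (s : seq R) (x0 c : R) (i : nat) :
  sorted >=%R s -> (i < size s)%N ->
  (c <= nth x0 s i) = (i < count (fun x : R => (c <= x)%R) s)%N.
Proof.
move=> ss si.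
have mono j k : (j <= k < size s)%N -> nth x0 s k <= nth x0 s j.
  move=> /andP[jk ks].
  have tr : transitive (>=%R : rel R) by move=> x y z xy yz; exact: le_trans yz xy.
  have rf : reflexive (>=%R : rel R) by move=> x; exact: lexx.
  by apply: (sorted_leq_nth tr rf x0 ss) => //; rewrite inE//; exact: leq_ltn_trans jk ks.
have [cs|sc] := leP c (nth x0 s i); apply/esym.
  rewrite -(cat_take_drop i.+1 s) count_cat ltn_addr//.
  have : all (fun x => c <= x) (take i.+1 s).
    apply/(all_nthP x0) => j; rewrite size_takel// => ji.
    by rewrite nth_take//; apply: le_trans cs _; apply: mono; rewrite -ltnS ji.
  by rewrite all_count size_takel// => /eqP ->.
apply/negbTE; rewrite -leqNgt -(cat_take_drop i s) count_cat.
have : ~~ has (fun x => c <= x) (drop i s).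
  rewrite -all_predC; apply/(all_nthP x0) => j; rewrite size_drop => ji.
  rewrite nth_drop /= -ltNge; apply: le_lt_trans sc; apply: mono.
  by rewrite leq_addr /= -ltn_subRL.
rewrite has_count -leqNgt leqn0 => /eqP ->.
by rewrite addn0 (leq_trans (count_size _ _))// size_takel// ltnW.
Qed.

Lemma measurable_fun_sort_tuple (R : realType) (d : measure_display)
    (T : measurableType d) (n : nat) (z : 'I_n -> T -> R) (i : 'I_n) :
  (forall j, measurable_fun setT (z j)) ->
  measurable_fun setT
    (fun t => tnth (sort_tuple >=%R [tuple z j t | j < n]) i).
Proof.
move=> mz.
apply: (measurability _ (RGenCInfty.measurableE R)) => _ [_ [c ->] <-].
pose N t : R := \sum_(j < n) \1_(z j @^-1` `[c, +oo[) t.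
have mN : measurable_fun setT N.
  apply: measurable_sum => j; apply: measurable_indic.
  by rewrite -[X in measurable X]setTI; exact: mz.
have -> : (fun t => tnth (sort_tuple >=%R [tuple z j t | j < n]) i)
      @^-1` `[c, +oo[ = N @^-1` `]i%:R, +oo[.
  apply/seteqP; suff E t : (c <= tnth (sort_tuple >=%R [tuple z j t | j < n]) i)
      = (i%:R < N t) by split=> t; rewrite /= !in_itv/= !andbT E.
  rewrite (tnth_nth 0) sorted_ge_nthP ?size_tuple//; last first.
    by apply: sort_sorted => x y; exact: le_total.
  rewrite count_sort count_map -sum1_count big_mkcond /= big_enum /=.
  rewrite -(ltr_nat R) natr_sum; congr (_ < _); apply: eq_bigr => j _.
  rewrite indicE; case: ifPn => cz; last rewrite memNset//=.
    by rewrite mem_set//= in_itv/= cz.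
  by rewrite in_itv/= andbT; apply/negP.
by rewrite setTI -[X in measurable X]setTI; exact: mN.
Qed.

(** The hypotheses concern only the balls of the first [r] batches, so that [T] may also carry the
    sigma-algebra generated by those balls. *)
Lemma measurable_batch_loads (R : realType) (d : measure_display)
    (T : measurableType d) (n b : nat) (w : nat -> T -> R)
    (a : nat -> T -> 'I_n) (r : nat) (i : 'I_n) :
  (forall t, (t < r * b)%N -> measurable_fun setT (w t)) ->
  (forall t j, (t < r * b)%N -> measurable (a t @^-1` [set j])) ->
  measurable_fun setT
    (fun x => tnth (batch_loads b (w ^~ x) (a ^~ x) r) i).
Proof.
elim: r i => [|r ih] i mw ma.
  have -> : (fun x => tnth (batch_loads b (w ^~ x) (a ^~ x) 0) i) = cst 0.
    by apply/funext => x /=; rewrite tnth_mktuple.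
  exact: measurable_cst.
have lt1 t : (t < r * b)%N -> (t < r.+1 * b)%N.
  by move=> /leq_trans; apply; rewrite leq_mul2r leqnSn orbT.
have lt2 (j : 'I_b) : (r * b + j < r.+1 * b)%N.
  by rewrite mulSn addnC ltn_add2r.
apply: measurable_fun_sort_tuple => j.
apply: measurable_funB.
  apply: measurable_funD; first by apply: ih => *; [apply: mw|apply: ma]; exact: lt1.
  apply: measurable_sum => k; apply: measurable_funM; first exact: mw.
  rewrite natr_eq_indic.
  by apply: measurable_indic; exact: ma.
apply: measurable_funM; first exact: measurable_cst.
by apply: measurable_sum => k; exact: mw.
Qed.

(** * Reduction of condition C1 to the extremal weights *)

Section rank_comparison.
Context (R : realType).

(** Summation by parts pairs the partial sums of [u] with the nonnegative decrements of [f]; the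
    boundary term vanishes with the full sum. *)
Lemma abel_ge0 (n : nat) (u f : nat -> R) :
  (forall k, (k <= n)%N -> 0 <= \sum_(i < k) u i) ->
  \sum_(i < n) u i = 0 ->
  (forall i j, (i <= j < n)%N -> f j <= f i) ->
  0 <= \sum_(i < n) u i * f i.
Proof.
move=> U0 Un fm.
suff H m : (m < n)%N ->
    (\sum_(i < m.+1) u i) * f m <= \sum_(i < m.+1) u i * f i.
  case: n U0 Un fm H => [|n] U0 Un fm H; first by rewrite big_ord0.
  by have := H n (ltnSn n); rewrite Un mul0r.
elim: m => [|m ih] mn; first by rewrite !big_ord1.
rewrite big_ord_recr/= [X in _ <= X]big_ord_recr/= mulrDl lerD2r.
apply: le_trans (ih (ltnW mn)); apply: ler_wpM2l.
  by apply: U0; exact: ltnW.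
by apply: fm; rewrite leqnSn.
Qed.

(* The bound that C1 puts, after division by eps, on the sums of n p_i - 1 over
   the k highest ranks: linear from 0 to - delta n, then linear back to 0. *)
Definition cap_profile (delta : R) (n k : nat) : R :=
  - Num.min k%:R (delta / (1 - delta) * (n%:R - k%:R)).

(** The extremal rank weights: - 1 when i + 1 <= delta n, delta / (1 - delta) when i >= delta n, and
    an intermediate value when delta n falls strictly between. *)
Definition cap_increment (delta : R) (n i : nat) : R :=
  cap_profile delta n i.+1 - cap_profile delta n i.

Lemma cap_profile_low (delta : R) (n k : nat) : delta < 1 ->
  k%:R <= delta * n%:R -> cap_profile delta n k = - k%:R.
Proof.
move=> d1 kn; rewrite /cap_profile min_l//.
rewrite mulrAC ler_pdivlMr; last lra.
by rewrite mulrBr; lra.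
Qed.

Lemma cap_profile_high (delta : R) (n k : nat) : delta < 1 ->
  delta * n%:R <= k%:R ->
  cap_profile delta n k = - (delta / (1 - delta) * (n%:R - k%:R)).
Proof.
move=> d1 kn; rewrite /cap_profile min_r//.
rewrite mulrAC ler_pdivrMr; last lra.
by rewrite mulrBr; lra.
Qed.

Lemma sum_cap_increment (delta : R) (n k : nat) :
  0 < delta -> delta < 1 -> (k <= n)%N ->
  \sum_(i < k) cap_increment delta n i = cap_profile delta n k.
Proof.
move=> d0 d1 kn.
rewrite -(big_mkord xpredT (cap_increment delta n)) telescope_sumr//.
suff -> : cap_profile delta n 0 = 0 by rewrite subr0.
by rewrite cap_profile_low ?mulr0n ?oppr0//; apply: mulr_ge0; rewrite ?ler0n// ltW.
Qed.

Lemma cap_increment_bound (delta : R) (n i : nat) : 0 < delta -> delta < 1 ->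
  `|cap_increment delta n i| <= 1 + delta / (1 - delta).
Proof.
move=> d0 d1; have t0 : 0 < delta / (1 - delta) by rewrite divr_gt0//; lra.
rewrite /cap_increment /cap_profile -natr1.
set t := delta / (1 - delta) in t0 *.
rewrite ler_norml !minEle; apply/andP.
by case: ifPn; case: ifPn; rewrite -?ltNge => H1 H2; split; nra.
Qed.

(** Up to delta n this is the first half of C1. Beyond it, the complement of the first k ranks
    starts at the 1-based rank k + 1, where the second half of C1 applies; for k = n both sides
    vanish. *)
Lemma condC1_cap (n : nat) (delta eps : R) (p : 'I_n -> R) :
  0 < delta -> delta < 1 -> 0 < eps -> (0 < n)%N ->
  prob_vector p -> condC1 delta eps p ->
  forall k, (k <= n)%N ->
  \sum_(i < n | (i < k)%N) (n%:R * p i - 1) <= eps * cap_profile delta n k.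
Proof.
move=> d0 d1 eps0 n0 [p0 p1] [c1 c2] k kn.
have nR : 0 < n%:R :> R by rewrite ltr0n.
rewrite sumrB -mulr_sumr sumr_const.
have -> : #|[pred i : 'I_n | (i < k)%N]| = k.
  rewrite -sum1_card -(big_ord_widen_cond n xpredT (fun=> 1%N))//.
  by rewrite sum1_card card_ord.
have [kd|kd] := leP k%:R (delta * n%:R).
  rewrite cap_profile_low//.
  case: k kn kd => [|k] kn kd.
    by rewrite big_pred0// mulr0 subr0 oppr0 mulr0.
  have := c1 k.+1 isT kd; rewrite mulrA ler_pdivlMr// => h.
  lra.
rewrite cap_profile_high//; last exact: ltW.
have split_p : \sum_(i < n | (i < k)%N) p i + \sum_(i < n | (k < i.+1)%N) p i = 1.
  rewrite -p1 [RHS](bigID (fun i : 'I_n => (i < k)%N))/=; congr (_ + _).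
  by apply: eq_bigl => i; rewrite -leqNgt ltnS.
have [kn'|kn'] := ltnP k n.
  have h1 : delta * n%:R + 1 <= k.+1%:R by rewrite -natr1; lra.
  have := c2 k.+1 h1 kn'; rewrite [leLHS]mulrA ler_pdivrMr// -natr1 => h.
  nra.
have -> : k = n by apply/eqP; rewrite eqn_leq kn kn'.
rewrite subrr mulr0 oppr0 mulr0.
have -> : \sum_(i < n | (i < n)%N) p i = 1.
  by rewrite -p1; apply: eq_bigl => i; rewrite ltn_ord.
by rewrite mulr1 subrr.
Qed.

End rank_comparison.

Lemma sorted_drift (R : realType) (n : nat) (delta eps : R) (p x : 'I_n -> R) :
  let theta := delta / (1 - delta) in
  0 < delta -> delta < 1 -> 0 < eps -> (0 < n)%N ->
  prob_vector p -> condC1 delta eps p ->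
  (forall i j : 'I_n, (i <= j)%N -> x j <= x i) -> \sum_i x i = 0 ->
  \sum_i (n%:R * p i - 1) * (expR (x i) - expR (- x i)) <=
  eps * (- (Num.min 1 theta / 6) * \sum_i (expR (x i) + expR (- x i))
         + (Num.min 1 theta + (1 + theta)) * n%:R).
Proof.
move=> theta d0 d1 e0 n0 pp c1 xs x0.
have t0 : 0 < theta by rewrite divr_gt0//; lra.
case: n n0 p x pp c1 xs x0 => // n _ p x pp c1 xs x0.
pose r (i : 'I_n.+1) := cap_increment R delta n.+1 i.
pose h (i : 'I_n.+1) := expR (x i) - expR (- x i).
have comparison : \sum_i (n.+1%:R * p i - 1) * h i <= eps * \sum_i r i * h i.
  (* By [condC1_cap] the partial sums of this difference are nonnegative, and its full sum is 0; [h]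
     is nonincreasing, so Abel summation applies. *)
  pose u (k : nat) := eps * cap_increment R delta n.+1 k - (n.+1%:R * p (inord k) - 1).
  have usum k : (k <= n.+1)%N -> \sum_(i < k) u i =
      eps * cap_profile R delta n.+1 k
      - \sum_(i < n.+1 | (i < k)%N) (n.+1%:R * p i - 1).
    move=> kn; rewrite sumrB -mulr_sumr sum_cap_increment//; congr (_ - _).
    rewrite (big_ord_widen _ (fun i => n.+1%:R * p (inord i) - 1) kn).
    by apply: eq_bigr => i _; rewrite inord_val.
  have : 0 <= \sum_(i < n.+1) u i * h (inord i).
    apply: (abel_ge0 R n.+1 u (fun k => h (inord k))).
    - move=> k kn; rewrite usum// subr_ge0.
      exact: condC1_cap.
    - rewrite sumrB -mulr_sumr sum_cap_increment// cap_profile_high//; last first.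
        by rewrite ger_pMl ?ltr0n// ltW.
      rewrite subrr mulr0 oppr0 mulr0 sub0r sumrB -mulr_sumr.
      under eq_bigr do rewrite inord_val.
      by case: pp => _ ->; rewrite sumr_const card_ord mulr1 subrr oppr0.
    - move=> i j /andP[ij jn].
      have : x (inord j) <= x (inord i).
        by apply: xs; rewrite !inordK// (leq_ltn_trans ij jn).
      by move=> xij; rewrite /h; apply: lerB; rewrite ler_expR// lerN2.
  move=> H; rewrite mulr_sumr -subr_ge0 -sumrB; apply: le_trans H _.
  rewrite le_eqVlt; apply/orP; left; apply/eqP; apply: eq_bigr => i _.
  rewrite /u /r inord_val; ring.
apply: le_trans comparison _; rewrite ler_pM2l//.
have ex0 : ((ord0 : 'I_n.+1)%:R : R) < delta * n.+1%:R by rewrite mulr_gt0// ltr0n.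
(* [i0] is the last 0-based rank below delta n: the weight is exactly - 1 before it and exactly
   [theta] after it. *)
case: (@arg_maxnP _ ord0 (fun i : 'I_n.+1 => i%:R < delta * n.+1%:R)
  (fun i => i : nat) ex0) => i0 i0d i0max.
have := @drift_sinh R 'I_n.+1 i0 r x (Num.min 1 theta) (1 + theta).
rewrite card_ord; apply => //.
- by rewrite lt_min ltr01.
- by rewrite ge_min; apply/orP; left; lra.
- rewrite /r (sum_cap_increment R delta n.+1 n.+1)// cap_profile_high//.
    by rewrite subrr mulr0 oppr0.
  by rewrite ger_pMl ?ltr0n// ltW.
- by move=> i; exact: cap_increment_bound.
- move=> i ii0; have [lt|gt|/val_inj eq] := ltngtP i i0; last by rewrite eq eqxx in ii0.
    left; split; last by apply: xs; exact: ltnW.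
    have l1 : i.+1%:R <= delta * n.+1%:R.
      by apply: le_trans (ltW i0d); rewrite ler_nat.
    have l2 : i%:R <= delta * n.+1%:R by apply: le_trans l1; rewrite ler_nat.
    rewrite /r /cap_increment !cap_profile_low// -natr1.
    have : Num.min 1 theta <= 1 by rewrite ge_min lexx.
    lra.
  right; split; last by apply: xs; exact: ltnW.
  have l2 : delta * n.+1%:R <= i%:R.
    by rewrite leNgt; apply/negP => /i0max /=; rewrite leqNgt gt.
  have l1 : delta * n.+1%:R <= i.+1%:R by apply: le_trans l2 _; rewrite ler_nat.
  rewrite /r /cap_increment !cap_profile_high// -natr1 -/theta.
  have : Num.min 1 theta <= theta by rewrite ge_min lexx orbT.
  lra.
Qed.

(** * Growth of exponential moments during a batch *)

Section balls.
Context (d : measure_display) (T : measurableType d) (R : realType)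
  (P : probability T R) (n : nat) (p : 'I_n -> R) (W : probability R R)
  (w : nat -> {RV P >-> R}) (a : nat -> T -> 'I_n).
Hypothesis smp : ball_samples p W w a.

Let samples (s : nat + nat) : set (set T) :=
  match s with
  | inl t => [set w t @^-1` A | A in measurable]
  | inr t => [set a t @^-1` B | B in [set: set 'I_n]]
  end.

Let history (N : nat) : set (nat + nat) :=
  [set s | match s with inl t => (t < N)%N | inr t => (t < N)%N end].

(** Generates the information available just before ball [N]. *)
Definition history_events (N : nat) : set (set T) :=
  joint_cylinders T (nat + nat)%type samples (history N).

Lemma rank_event_measurable t (B : set 'I_n) : measurable (a t @^-1` B).
Proof.
have -> : a t @^-1` B = \bigcup_(i in B) a t @^-1` [set i].
  by apply/seteqP; split => [x Bx|x [i Bi /= ai]]; [exists (a t x)|rewrite /= ai].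
apply: fin_bigcup_measurable; first exact: finite_finset.
by move=> i _; exact: (rank_measurable smp).
Qed.

Let samples_measurable s : samples s `<=` measurable.
Proof.
case: s => t A /=.
  by move=> [B mB <-]; rewrite -[X in measurable X]setTI; exact: measurable_funP.
by move=> [B _ <-]; exact: rank_event_measurable.
Qed.

Let samplesT s : samples s setT.
Proof. by case: s => t /=; exists setT. Qed.

Let samplesI s : setI_closed (samples s).
Proof.
case: s => t A B /= [A' mA' <-] [B' mB' <-]; exists (A' `&` B') => //.
exact: measurableI.
Qed.

Let sub_cylinders (K K' : set (nat + nat)) (f : T -> R) : K `<=` K' ->
  measurable_fun (setT : set (g_sigma_algebraType
    (joint_cylinders T (nat + nat)%type samples K))) f ->
  measurable_fun (setT : set (g_sigma_algebraType
    (joint_cylinders T (nat + nat)%type samples K'))) f.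
Proof.
move=> KK' mf _ B mB.
have : <<s joint_cylinders T (nat + nat)%type samples K >> (setT `&` f @^-1` B).
  exact: mf.
apply: sub_smallest2r; first exact: smallest_sigma_algebra.
move=> A [J [E [uJ JE ->]]].
exists J, E; split => // i /JE[Ki ?]; split => //; exact: KK'.
Qed.

Lemma history_mono (N N' : nat) (f : T -> R) : (N <= N')%N ->
  measurable_fun (setT : set (g_sigma_algebraType (history_events N))) f ->
  measurable_fun (setT : set (g_sigma_algebraType (history_events N'))) f.
Proof.
move=> NN'; apply: sub_cylinders => -[t|t] /= tN; exact: leq_trans tN NN'.
Qed.

Lemma weight_history (N t : nat) : (t < N)%N ->
  measurable_fun (setT : set (g_sigma_algebraType (history_events N))) (w t).
Proof.
move=> tN _ B mB; rewrite setTI; apply: sub_sigma_algebra.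
by apply: (@sub_joint_cylinders _ _ _ _ _ (inl t)) => //=; exists B.
Qed.

Lemma rank_history (N t : nat) (B : set 'I_n) : (t < N)%N ->
  measurable (a t @^-1` B : set (g_sigma_algebraType (history_events N))).
Proof.
move=> tN; apply: sub_sigma_algebra.
by apply: (@sub_joint_cylinders _ _ _ _ _ (inr t)) => //=; exists B.
Qed.

Lemma history_measurable (N : nat) (f : T -> R) :
  measurable_fun (setT : set (g_sigma_algebraType (history_events N))) f ->
  measurable_fun setT f.
Proof. exact: measurable_fun_joint_cylinders. Qed.

Lemma integral_weight (t : nat) (c : R) :
  (\int[P]_x (expR (c * w t x))%:E = 'E_W[fun x => expR (c * x)])%E.
Proof.
rewrite unlock.
have me : measurable_fun setT (fun x : R => (expR (c * x))%:E).
  by apply/measurable_EFinP; apply: measurableT_comp.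
rewrite -(@eq_measure_integral _ R R setT _ (distribution P (w t))); last first.
  by move=> A mA _; exact: (weight_distr smp).
by rewrite /distribution ge0_integral_pushforward.
Qed.

Lemma integral_ball (N : nat) (f : T -> R) (B : set 'I_n) (c : R) :
  measurable_fun (setT : set (g_sigma_algebraType (history_events N))) f ->
  (forall x, 0 <= f x) ->
  (\int[P]_x (f x * \1_B (a N x) * expR (c * w N x))%:E =
   \int[P]_x (f x)%:E * P (a N @^-1` B) * 'E_W[fun x => expR (c * x)])%E.
Proof.
move=> mf f0.
have ind0 x : 0 <= \1_B (a N x) :> R by rewrite indicE ler0n.
(* Two splittings: the weight of ball [N] is independent of the history together with the rank of
   that ball, and this rank is independent of the history. *)
pose K := [set s | history N s \/ s = inr N].
rewrite (@ge0_integralM_joint_cylinders _ _ _ P _ samples samples_measurable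
  samplesT samplesI K (inl N)); first last.
- by move=> x; exact: expR_ge0.
- by move=> x; rewrite mulr_ge0.
- move=> A mA /=; exists ((fun x : R => expR (c * x)) @^-1` A) => //.
  rewrite -[X in measurable X]setTI.
  have : measurable_fun setT (fun x : R => expR (c * x)) by apply: measurableT_comp.
  exact.
- apply: measurable_funM.
    by apply: (@sub_cylinders (history N)) => // s; left.
  have -> : (fun x => \1_B (a N x)) = \1_(a N @^-1` B) :> (T -> R) by [].
  apply: measurable_indic; apply: sub_sigma_algebra.
  by apply: (@sub_joint_cylinders _ _ _ _ _ (inr N)); [right|exists B].
- by move=> [|//]; rewrite /history /= ltnn.
- exact: (samples_independent smp).
rewrite integral_weight; congr (_ * _)%E.
rewrite (@ge0_integralM_joint_cylinders _ _ _ P _ samples samples_measurable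
  samplesT samplesI (history N) (inr N))//; first last.
- by move=> A mA /=; exists ((\1_B : 'I_n -> R) @^-1` A).
- by rewrite /history /= ltnn.
- exact: (samples_independent smp).
congr (_ * _)%E.
have -> : (fun x => (\1_B (a N x))%:E)
    = (fun x => (\1_(a N @^-1` B) x)%:E :> \bar R) by [].
rewrite integral_indic ?setIT//.
exact: rank_event_measurable.
Qed.

End balls.

Arguments history_events {d T R P n} w a N.

Section batch_growth.
Context (d : measure_display) (T : measurableType d) (R : realType)
  (P : probability T R) (n : nat) (p : 'I_n -> R) (W : probability R R)
  (w : nat -> {RV P >-> R}) (a : nat -> T -> 'I_n).

(* sg = 1 and sg = -1 are the two exponentials of the potential. *)
Lemma ball_growth (lambda S C alpha sg : R) (N : nat) (i : 'I_n) (f : T -> R) :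
  prob_vector p -> condC2 C p -> weight_law lambda S W ->
  ball_samples p W w a -> 1 <= S ->
  0 < alpha -> alpha < Num.min (lambda / 2) 1 -> -1 <= sg -> sg <= 1 ->
  measurable_fun (setT : set (g_sigma_algebraType (history_events w a N))) f ->
  (forall x, 0 <= f x) ->
  (\int[P]_x (f x * expR (sg * alpha * (w N x * ((a N x == i)%:R - n%:R^-1))))%:E
   <= (1 + sg * alpha * (p i - n%:R^-1) + S * (C + 1) * alpha ^+ 2 / n%:R)%:E
      * \int[P]_x (f x)%:E)%E.
Proof.
move=> [p0 p1] pC [_ _ _ WS] smp S1 al0 al1 sg1 sg2 mf f0.
have n0 : (0 < n)%N by case: i => m; exact: leq_ltn_trans.
have nR : 0 < n%:R :> R by rewrite ltr0n.
set nu := n%:R^-1 : R.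
have nu0 : 0 < nu by rewrite invr_gt0.
have nu1 : nu <= 1 by rewrite invf_le1// ler1n.
have piC : p i <= C * nu by apply: le_trans pC; apply: le_bigmax.
have pi1 : p i <= 1.
  by rewrite -p1 (bigD1 i)//= lerDl sumr_ge0.
pose B := [set i].
pose g1 x := f x * \1_B (a N x) * expR (alpha * (sg * (1 - nu)) * w N x).
pose g2 x := f x * \1_(~` B) (a N x) * expR (alpha * (- sg * nu) * w N x).
have mind (D : set 'I_n) : measurable_fun setT (fun x => \1_D (a N x) : R).
  have -> : (fun x => \1_D (a N x)) = \1_(a N @^-1` D) :> (T -> R) by [].
  by apply: measurable_indic; exact: (rank_event_measurable _ _ _ _ _ _ _ _ _ smp).
have mexp c : measurable_fun setT (fun x => expR (c * w N x)).
  by apply: measurableT_comp => //; apply: measurable_funM.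
have mft : measurable_fun setT f.
  exact: (history_measurable _ _ _ _ _ _ _ _ _ smp N).
have ind0 (D : set 'I_n) x : 0 <= \1_D (a N x) :> R by rewrite indicE ler0n.
have -> : (\int[P]_x (f x * expR (sg * alpha * (w N x * ((a N x == i)%:R - nu))))%:E
    = \int[P]_x (g1 x)%:E + \int[P]_x (g2 x)%:E)%E.
  rewrite -ge0_integralD//.
  - apply: eq_integral => x _; rewrite -EFinD; congr EFin.
    rewrite /g1 /g2 !indicE in_setC.
    have -> : (a N x \in B) = (a N x == i).
      by apply/idP/eqP => [/set_mem//|ai]; exact: mem_set.
    case: eqP => _ /=; rewrite ?mulr1 ?mulr0 ?mul0r ?addr0 ?add0r;
      by congr (_ * expR _); ring.
  - by move=> x _; rewrite lee_fin !mulr_ge0// expR_ge0.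
  - by apply/measurable_EFinP; apply: measurable_funM => //; apply: measurable_funM.
  - by move=> x _; rewrite lee_fin !mulr_ge0// expR_ge0.
  - by apply/measurable_EFinP; apply: measurable_funM => //; apply: measurable_funM.
have PB : P (a N @^-1` B) = (p i)%:E by exact: (rank_distr smp).
have PB' : P (a N @^-1` (~` B)) = (1 - p i)%:E.
  rewrite -preimage_setC probability_setC ?PB//.
  exact: (rank_event_measurable _ _ _ _ _ _ _ _ _ smp).
rewrite !(integral_ball _ _ _ _ _ _ _ _ _ smp)// PB PB'.
set If := (\int[P]_x (f x)%:E)%E.
have If0 : (0 <= If)%E by apply: integral_ge0 => x _; rewrite lee_fin.
have step q u (E : \bar R) : 0 <= q -> (E <= u%:E)%E ->
    (If * q%:E * E <= (q * u)%:E * If)%E.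
  move=> q0 Eu; rewrite EFinM [leRHS]muleC muleA; apply: lee_wpmul2l => //.
  by rewrite mule_ge0.
apply: (le_trans (leeD (step _ _ _ (p0 i) (WS alpha (sg * (1 - nu)) al0 al1 _ _))
  (step _ _ _ _ (WS alpha (- sg * nu) al0 al1 _ _)))); [nra|nra|lra|nra|nra|].
set u1 := (X in (_ * X)%:E); set u2 := (X in (_ + (_ * X)%:E * _)%E).
have s2 : sg ^+ 2 <= 1 by nra.
(* The linear terms average to sg (p_i - 1/n); the averaged squares are at most C/n + 1/n by [q1]
   and [q2], which gives the factor [S * (C + 1)]. *)
have q1 : p i * (sg * (1 - nu)) ^+ 2 <= C * nu.
  apply: le_trans piC; rewrite ler_piMr// exprMn.
  by rewrite mulr_ile1 ?sqr_ge0//; nra.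
have q2 : (1 - p i) * (- sg * nu) ^+ 2 <= nu.
  have h : (- sg * nu) ^+ 2 <= nu.
    rewrite exprMn sqrrN; apply: (@le_trans _ _ (1 * nu ^+ 2)).
      by rewrite ler_wpM2r// sqr_ge0.
    by rewrite mul1r expr2 ler_piMl// ltW.
  apply: le_trans h; rewrite ler_piMl ?sqr_ge0//; have := p0 i; lra.
have u0 k u : ('E_W[fun x => expR (alpha * k * x)] <= u%:E)%E -> 0 <= u.
  rewrite -lee_fin; apply: le_trans; rewrite unlock.
  by apply: integral_ge0 => x _; rewrite lee_fin expR_ge0.
rewrite -ge0_muleDl; last 2 first.
- rewrite lee_fin mulr_ge0//; apply: (u0 (sg * (1 - nu))); apply: WS => //; nra.
- rewrite lee_fin mulr_ge0//; first lra.
  apply: (u0 (- sg * nu)); apply: WS => //; nra.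
apply: lee_wpmul2r => //; rewrite -EFinD lee_fin /u1 /u2.
have SA : 0 <= S * alpha ^+ 2 by rewrite mulr_ge0 ?sqr_ge0//; lra.
have := ler_wpM2l SA q1; have := ler_wpM2l SA q2.
nra.
Qed.

End batch_growth.

Lemma prob_vector_le1 (R : realType) (n : nat) (p : 'I_n -> R) (i : 'I_n) :
  prob_vector p -> 0 <= p i /\ p i <= 1.
Proof.
by move=> [p0 p1]; split => //; rewrite -p1 (bigD1 i)//= lerDl sumr_ge0.
Qed.

Lemma growth_base_ge0 (R : realType) (n : nat) (p : 'I_n -> R) (i : 'I_n)
    (S C alpha sg : R) :
  prob_vector p -> 1 < C -> 1 <= S ->
  0 < alpha -> alpha < 1 -> -1 <= sg -> sg <= 1 ->
  0 <= 1 + sg * alpha * (p i - n%:R^-1) + S * (C + 1) * alpha ^+ 2 / n%:R.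
Proof.
move=> pp C1 S1 al0 al1 sg1 sg2.
have n0 : (0 < n)%N by case: (i) => ?; exact: leq_ltn_trans.
have nu0 : 0 < n%:R^-1 :> R by rewrite invr_gt0 ltr0n.
have nu1 : n%:R^-1 <= 1 :> R by rewrite invf_le1 ?ltr0n// ler1n.
have [pi0 pi1] := prob_vector_le1 R n p i pp.
have : `|sg * alpha * (p i - n%:R^-1)| <= 1.
  by rewrite !normrM mulr_ile1 ?mulr_ge0// ?mulr_ile1// ler_norml; lra.
have h2 : 0 <= S * (C + 1) * alpha ^+ 2 / n%:R.
  by rewrite !mulr_ge0 ?sqr_ge0 ?ltW//; lra.
rewrite ler_norml => /andP[h _]; lra.
Qed.

(** Ranks refer to the start of the batch, so every ball contributes the same factor. The induction
    absorbs the earlier balls of the batch into the history-measurable function of [ball_growth]. *)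
Lemma batch_growth (d : measure_display) (T : measurableType d) (R : realType)
    (P : probability T R) (n : nat) (p : 'I_n -> R) (W : probability R R)
    (w : nat -> {RV P >-> R}) (a : nat -> T -> 'I_n)
    (lambda S C alpha sg : R) (N k : nat) (i : 'I_n) (f : T -> R) :
  prob_vector p -> condC2 C p -> weight_law lambda S W ->
  ball_samples p W w a -> 1 < C -> 1 <= S ->
  0 < alpha -> alpha < Num.min (lambda / 2) 1 -> -1 <= sg -> sg <= 1 ->
  measurable_fun (setT : set (g_sigma_algebraType (history_events w a N))) f ->
  (forall x, 0 <= f x) ->
  (\int[P]_x (f x * \prod_(j < k) expR (sg * alpha *
     (w (N + j)%N x * ((a (N + j)%N x == i)%:R - n%:R^-1))))%:E
   <= ((1 + sg * alpha * (p i - n%:R^-1) + S * (C + 1) * alpha ^+ 2 / n%:R) ^+ k)%:E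
      * \int[P]_x (f x)%:E)%E.
Proof.
move=> pp pC WL smp C1 S1 al0 al1 sg1 sg2 mf f0.
set m := 1 + _ + _.
have m0 : 0 <= m.
  by apply: growth_base_ge0 => //; move: al1; rewrite lt_min => /andP[].
elim: k => [|k ih].
  rewrite expr0 mul1e; under eq_integral do rewrite big_ord0 mulr1.
  by [].
pose g x := f x * \prod_(j < k) expR (sg * alpha *
     (w (N + j)%N x * ((a (N + j)%N x == i)%:R - n%:R^-1))).
have g0 x : 0 <= g x by rewrite mulr_ge0// prodr_ge0// => j _; exact: expR_ge0.
have mg : measurable_fun
    (setT : set (g_sigma_algebraType (history_events w a (N + k)))) g.
  apply: measurable_funM.
    by apply: history_mono mf; rewrite leq_addr.
  apply: measurable_prod => j _.
  apply: measurableT_comp => //; apply: measurable_funM => //.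
  have jk : (N + j < N + k)%N by rewrite ltn_add2l.
  apply: measurable_funM; first exact: weight_history.
  apply: measurable_funB => //.
  rewrite natr_eq_indic.
  by apply: measurable_indic; exact: rank_history.
have stepk := @ball_growth _ _ _ P n p W w a lambda S C alpha sg (N + k) i g
  pp pC WL smp S1 al0 al1 sg1 sg2 mg g0.
rewrite -/m in stepk.
under eq_integral do rewrite big_ord_recr/= mulrA.
apply: (le_trans stepk); rewrite exprS EFinM -muleA.
by apply: lee_wpmul2l => //; rewrite lee_fin.
Qed.

(** Here [q] stands for n p_i - 1. The power m^b is at most exp (b (m - 1)), and n <= b gives alpha
    <= beta, so the exponent is at most [X]; the quadratic bound on exp applies as |X| <= beta (C +
    B0) <= 1/2. *)
Lemma growth_factor_le (R : realType) (n b : nat) (q B0 C alpha sg : R) :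
  let beta := alpha * (b%:R / n%:R) in
  (0 < n)%N -> (n <= b)%N -> 0 < B0 -> 1 < C -> 0 < alpha -> beta <= 1 ->
  beta * (C + B0) <= 1 / 2 -> -1 <= sg -> sg <= 1 -> -1 <= q -> q <= C ->
  0 <= 1 + sg * alpha * (q / n%:R) + B0 * alpha ^+ 2 / n%:R ->
  (1 + sg * alpha * (q / n%:R) + B0 * alpha ^+ 2 / n%:R) ^+ b
    <= 1 + sg * (beta * q) + (B0 + 2 * (C + B0) ^+ 2) * beta ^+ 2.
Proof.
move=> beta n0 nb B00 C1 al0 be1 beC sg1 sg2 q1 q2 m0.
have nR : 0 < n%:R :> R by rewrite ltr0n.
set m := 1 + _ + _ in m0 *.
have be0 : 0 < beta by rewrite mulr_gt0// divr_gt0// ltr0n (leq_trans n0).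
have albe : alpha <= beta.
  by apply: ler_peMr; [exact: ltW|rewrite ler_pdivlMr// mul1r ler_nat].
pose X := sg * (beta * q) + B0 * beta ^+ 2.
have mX : b%:R * (m - 1) <= X.
  have -> : b%:R * (m - 1) = sg * (beta * q) + B0 * (alpha * beta).
    rewrite /m /beta; field; lra.
  rewrite /X lerD2l; apply: ler_wpM2l; first exact: ltW.
  by rewrite expr2; apply: ler_wpM2r => //; exact: ltW.
have aq : `|sg * (beta * q)| <= beta * C.
  rewrite normrM (normrM beta) (gtr0_norm be0) -[leRHS]mul1r; apply: ler_pM => //.
  - by rewrite mulr_ge0// ltW.
  - by rewrite ler_norml; lra.
  - by apply: ler_wpM2l; [exact: ltW|rewrite ler_norml; lra].
have b2 : 0 <= B0 * beta ^+ 2 /\ B0 * beta ^+ 2 <= beta * B0.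
  split; first by rewrite mulr_ge0 ?sqr_ge0// ltW.
  rewrite [leRHS]mulrC; apply: ler_wpM2l; first exact: ltW.
  by rewrite expr2; apply: ler_piMl => //; exact: ltW.
have aX : `|X| <= beta * (C + B0).
  move: aq; rewrite !ler_norml /X mulrDr => /andP[h1 h2]; case: b2 => h3 h4.
  apply/andP; split; lra.
have e1 : m ^+ b <= expR (b%:R * (m - 1)).
  rewrite expRM_natl; apply: lerXn2r; rewrite ?nnegrE ?expR_ge0//.
  by have := expR_ge1Dx (m - 1); rewrite addrC subrK.
apply: (le_trans e1); apply: (@le_trans _ _ (expR X)); first by rewrite ler_expR.
have X1 : X <= 1 / 2 by move: aX; rewrite ler_norml => /andP[_ h]; lra.
apply: le_trans (expR_le_quadratic R X X1) _.
have : X ^+ 2 <= (beta * (C + B0)) ^+ 2.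
  rewrite -real_normK ?num_real//; apply: lerXn2r; rewrite ?nnegrE//.
  by rewrite mulr_ge0//; lra.
rewrite exprMn /X; nra.
Qed.

(** * The potential of the loads *)

Section loads.
Context (R : realType).

Definition potential (alpha : R) (n : nat) (y : n.-tuple R) : R :=
  \sum_(i < n) (expR (alpha * tnth y i) + expR (- (alpha * tnth y i))).

Lemma sum_sort_tuple (n : nat) (leT : rel R) (t : n.-tuple R) (F : R -> R) :
  \sum_(i < n) F (tnth (sort_tuple leT t) i) = \sum_(i < n) F (tnth t i).
Proof.
rewrite -(big_tuple _ _ _ xpredT F) -[RHS](big_tuple _ _ _ xpredT F).
by apply: perm_big; rewrite perm_sort.
Qed.

Lemma batch_loads_nonincreasing (n b : nat) (w : nat -> R) (a : nat -> 'I_n)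
    (r : nat) (i j : 'I_n) : (i <= j)%N ->
  tnth (batch_loads b w a r) j <= tnth (batch_loads b w a r) i.
Proof.
move=> ij; case: r => [|r]; first by rewrite !tnth_mktuple.
rewrite !(tnth_nth 0) /=.
have tr : transitive (>=%R : rel R) by move=> x y z xy yz; exact: le_trans yz xy.
have rf : reflexive (>=%R : rel R) by move=> x; exact: lexx.
apply: (sorted_leq_nth tr rf 0) => //; rewrite ?inE ?size_sort ?size_tuple ?card_ord//.
by apply: sort_sorted => x y; exact: le_total.
Qed.

Lemma sum_batch_loads (n b : nat) (w : nat -> R) (a : nat -> 'I_n) (r : nat) :
  (0 < n)%N -> \sum_(i < n) tnth (batch_loads b w a r) i = 0.
Proof.
move=> n0; elim: r => [|r ih].
  by apply: big1 => i _; rewrite tnth_mktuple.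
rewrite /= (sum_sort_tuple n _ _ id) /=.
under eq_bigr do rewrite tnth_mktuple.
rewrite sumrB big_split/= ih add0r exchange_big/=.
rewrite sumr_const card_ord -(mulr_natl (n%:R^-1 * _)) mulrA.
rewrite mulfV ?mul1r ?pnatr_eq0 -?lt0n//.
apply/eqP; rewrite subr_eq0; apply/eqP; apply: eq_bigr => j _.
rewrite -mulr_sumr (bigD1 (a (r * b + j)%N))//= eqxx big1 ?addr0 ?mulr1// => i.
by rewrite eq_sym => /negbTE ->.
Qed.

(** [sorted_drift] yields the rate [kap / 6]; half of it absorbs the second-order error
    [K * beta ^+ 2], which leaves [kap / 12]. *)
Lemma potential_drift (n b r : nat) (w : nat -> R) (a : nat -> 'I_n)
    (delta eps alpha beta K : R) (p : 'I_n -> R) :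
  let theta := delta / (1 - delta) in
  let kap := Num.min 1 theta in
  let y := batch_loads b w a r in
  0 < delta -> delta < 1 -> 0 < eps -> (0 < n)%N ->
  prob_vector p -> condC1 delta eps p ->
  0 < alpha -> 0 < beta -> K * beta <= kap * eps / 12 ->
  \sum_(i < n)
    ((1 + beta * (n%:R * p i - 1) + K * beta ^+ 2) * expR (alpha * tnth y i)
     + (1 - beta * (n%:R * p i - 1) + K * beta ^+ 2) * expR (- (alpha * tnth y i)))
  <= (1 - beta * eps * (kap / 12)) * potential alpha n y
     + beta * eps * (kap + (1 + theta)) * n%:R.
Proof.
move=> theta kap y d0 d1 e0 n0 pp c1 al0 be0 Kb.
have mono (i j : 'I_n) : (i <= j)%N -> alpha * tnth y j <= alpha * tnth y i.
  by move=> ij; rewrite ler_pM2l//; exact: batch_loads_nonincreasing.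
have sum0 : \sum_i alpha * tnth y i = 0.
  by rewrite -mulr_sumr sum_batch_loads// mulr0.
have := @sorted_drift R n delta eps p _ d0 d1 e0 n0 pp c1 mono sum0.
rewrite -/theta -/kap.
set H := \sum_i _ * _; rewrite -/(potential alpha n y) => drift.
have G0 : 0 <= potential alpha n y.
  by apply: sumr_ge0 => i _; rewrite addr_ge0// expR_ge0.
have -> : \sum_(i < n)
    ((1 + beta * (n%:R * p i - 1) + K * beta ^+ 2) * expR (alpha * tnth y i)
     + (1 - beta * (n%:R * p i - 1) + K * beta ^+ 2) * expR (- (alpha * tnth y i)))
    = (1 + K * beta ^+ 2) * potential alpha n y + beta * H.
  rewrite /potential /H !mulr_sumr -big_split/=; apply: eq_bigr => i _; ring.
have := ler_wpM2l (ltW be0) drift.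
have : K * beta ^+ 2 * potential alpha n y
     <= beta * (kap * eps / 12) * potential alpha n y.
  by apply: ler_wpM2r => //; rewrite expr2 mulrA [leLHS]mulrC ler_pM2l.
lra.
Qed.

End loads.

(** * Contraction and uniform bound of the expected potential *)

Section expected_potential.
Context (d : measure_display) (T : measurableType d) (R : realType)
  (P : probability T R) (n b : nat) (p : 'I_n -> R) (W : probability R R)
  (w : nat -> {RV P >-> R}) (a : nat -> T -> 'I_n).

Let y (r : nat) (x : T) : n.-tuple R :=
  batch_loads b (fun t => w t x) (fun t => a t x) r.

Let z (r : nat) (i : 'I_n) (x : T) : R := tnth (y r x) i
  + \sum_(j < b) w (r * b + j)%N x * (a (r * b + j)%N x == i)%:R
  - n%:R^-1 * \sum_(j < b) w (r * b + j)%N x.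

Lemma measurable_loads r i : ball_samples p W w a ->
  measurable_fun setT (fun x => tnth (y r x) i).
Proof.
move=> smp; apply: (@measurable_batch_loads _ _ T n b (fun t x => w t x) a) => //.
by move=> t j _; exact: (rank_measurable smp).
Qed.

Lemma measurable_potential alpha r : ball_samples p W w a ->
  measurable_fun setT (fun x => potential R alpha n (y r x)).
Proof.
move=> smp; apply: measurable_sum => i.
have m1 : measurable_fun setT (fun x => alpha * tnth (y r x) i).
  by apply: measurable_funM => //; exact: measurable_loads.
by apply: measurable_funD; apply: measurableT_comp => //; exact: measurableT_comp.
Qed.

Lemma integral_exp_load_le (lambda S C alpha sg : R) (r : nat) (i : 'I_n) :
  let beta := alpha * (b%:R / n%:R) in
  let B0 := S * (C + 1) in
  prob_vector p -> condC2 C p -> weight_law lambda S W ->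
  ball_samples p W w a -> (n <= b)%N -> 1 < C -> 1 <= S ->
  0 < alpha -> alpha < Num.min (lambda / 2) 1 -> -1 <= sg -> sg <= 1 ->
  beta <= 1 -> beta * (C + B0) <= 1 / 2 ->
  (\int[P]_x (expR (sg * alpha * z r i x))%:E <=
   (1 + sg * (beta * (n%:R * p i - 1))
      + (B0 + 2 * (C + B0) ^+ 2) * beta ^+ 2)%:E
   * \int[P]_x (expR (sg * alpha * tnth (y r x) i))%:E)%E.
Proof.
move=> beta B0 pp pC WL smp nb C1 S1 al0 al1 sg1 sg2 be1 beC.
have n0 : (0 < n)%N by case: (i) => ?; exact: leq_ltn_trans.
have nR : 0 < n%:R :> R by rewrite ltr0n.
have [pi0 pi1] := prob_vector_le1 R n p i pp.
have piC : p i <= C / n%:R by apply: le_trans pC; apply: le_bigmax.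
have al2 : alpha < 1 by move: al1; rewrite lt_min => /andP[].
pose f x := expR (sg * alpha * tnth (y r x) i).
have mf : measurable_fun
    (setT : set (g_sigma_algebraType (history_events w a (r * b)))) f.
  apply: measurableT_comp => //; apply: measurable_funM => //.
  apply: (@measurable_batch_loads _ _ (g_sigma_algebraType
    (history_events w a (r * b))) n b (fun t x => w t x) a) => [t tr|t j tr].
    exact: weight_history.
  exact: rank_history.
have f0 x : 0 <= f x by exact: expR_ge0.
have := @batch_growth _ _ _ P n p W w a lambda S C alpha sg (r * b) b i f
  pp pC WL smp C1 S1 al0 al1 sg1 sg2 mf f0.
have -> : (\int[P]_x (expR (sg * alpha * z r i x))%:E =
  \int[P]_x (f x * \prod_(j < b) expR (sg * alpha *
     (w (r * b + j)%N x * ((a (r * b + j)%N x == i)%:R - n%:R^-1))))%:E)%E.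
  apply: eq_integral => x _; rewrite -expR_sum -expRD -mulr_sumr -mulrDr.
  congr (expR (_ * _))%:E; rewrite /z -addrA; congr (_ + _).
  rewrite mulr_sumr -sumrB; apply: eq_bigr => j _; ring.
move=> /le_trans; apply; apply: lee_wpmul2r.
  by apply: integral_ge0 => x _; rewrite lee_fin.
rewrite lee_fin.
have eq : p i - n%:R^-1 = (n%:R * p i - 1) / n%:R by field; rewrite gt_eqF.
rewrite eq; apply: growth_factor_le => //.
- by rewrite /B0; nra.
- by rewrite lerBrDr addNr mulr_ge0.
- by move: piC; rewrite ler_pdivlMr//; lra.
- by rewrite -eq; exact: growth_base_ge0.
Qed.

(** Each exponential is bounded in expectation with the loads at the start of the batch; once the
    bounds are gathered under one integral, [potential_drift] applies pointwise. *)
Lemma expected_potential_step (delta eps lambda S C alpha : R) (r : nat) :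
  let beta := alpha * (b%:R / n%:R) in
  let B0 := S * (C + 1) in
  let theta := delta / (1 - delta) in
  let kap := Num.min 1 theta in
  0 < delta -> delta < 1 -> 0 < eps -> eps < 1 -> (0 < n)%N ->
  prob_vector p -> condC1 delta eps p -> condC2 C p -> weight_law lambda S W ->
  ball_samples p W w a -> (n <= b)%N -> 1 < C -> 1 <= S ->
  0 < alpha -> alpha < Num.min (lambda / 2) 1 ->
  beta <= 1 -> beta * (C + B0) <= 1 / 2 ->
  (B0 + 2 * (C + B0) ^+ 2) * beta <= kap * eps / 12 ->
  (\int[P]_x (potential R alpha n (y r.+1 x))%:E <=
   (1 - beta * eps * (kap / 12))%:E * \int[P]_x (potential R alpha n (y r x))%:E
   + (beta * eps * (kap + (1 + theta)) * n%:R)%:E)%E.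
Proof.
move=> beta B0 theta kap d0 d1 e0 e1 n0 pp c1 pC WL smp nb C1 S1 al0 al1 be1 beC Kb.
have nR : 0 < n%:R :> R by rewrite ltr0n.
have bR : 0 < b%:R :> R by rewrite ltr0n (leq_trans n0).
have be0 : 0 < beta by rewrite mulr_gt0// divr_gt0.
have t0 : 0 < theta by rewrite divr_gt0//; lra.
have kap0 : 0 < kap by rewrite lt_min ltr01.
have kap1 : kap <= 1 by rewrite ge_min lexx.
set K := B0 + _ in Kb *.
pose ey sg i x := expR (sg * alpha * tnth (y r x) i).
pose c sg i := 1 + sg * (beta * (n%:R * p i - 1)) + K * beta ^+ 2.
(* Linearity of the integral is used in its version for nonnegative integrands, so the coefficients
   must be nonnegative. *)
have c0 sg i : -1 <= sg -> sg <= 1 -> 0 <= c sg i.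
  move=> s1 s2.
  have B0_gt0 : 0 < B0 by rewrite /B0; nra.
  have piC : p i <= C / n%:R by apply: le_trans pC; apply: le_bigmax.
  have [pi0 pi1] := prob_vector_le1 R n p i pp.
  have q1 : 0 <= n%:R * p i by rewrite mulr_ge0.
  have q2 : n%:R * p i <= C by rewrite mulrC -ler_pdivlMr.
  have : `|sg * (beta * (n%:R * p i - 1))| <= 1.
    rewrite normrM mulr_ile1 ?ler_norml; [|by []|by []|lra|].
      by [].
    apply/andP; split; nra.
  rewrite ler_norml /c => /andP[h _].
  have : 0 <= K * beta ^+ 2 by rewrite mulr_ge0 ?sqr_ge0// /K; nra.
  lra.
have mz i : measurable_fun setT (z r i).
  apply: measurable_funB.
    apply: measurable_funD; first exact: measurable_loads.
    apply: measurable_sum => k; apply: measurable_funM => //.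
    rewrite natr_eq_indic.
    by apply: measurable_indic; exact: (rank_measurable smp).
  by apply: measurable_funM => //; apply: measurable_sum.
have mexp sg (f : T -> R) : measurable_fun setT f ->
    measurable_fun setT (fun x => (expR (sg * alpha * f x))%:E).
  move=> mf; apply/measurable_EFinP; apply: measurableT_comp => //.
  exact: measurable_funM.
have my i := measurable_loads r i smp.
have -> : (\int[P]_x (potential R alpha n (y r.+1 x))%:E =
    \sum_(i < n) (\int[P]_x (expR (1 * alpha * z r i x))%:E
                  + \int[P]_x (expR (-1 * alpha * z r i x))%:E))%E.
  transitivity (\int[P]_x \sum_(i < n) ((expR (1 * alpha * z r i x))%:E
      + (expR (-1 * alpha * z r i x))%:E))%E.
    apply: eq_integral => x _; rewrite /potential /=.
    (* The potential is symmetric in the loads, so the sorting at the end of the batch can be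
       undone. *)
    rewrite (@sum_sort_tuple R n _ _
      (fun u => expR (alpha * u) + expR (- (alpha * u)))).
    rewrite -sumEFin; apply: eq_bigr => i _; rewrite tnth_mktuple EFinD.
    by rewrite mul1r mulN1r mulNr.
  rewrite ge0_integral_sum//.
  - by apply: eq_bigr => i _; rewrite ge0_integralD//; exact: mexp.
  - by move=> i; apply: emeasurable_funD; exact: mexp.
  - by move=> i x _; rewrite adde_ge0// lee_fin expR_ge0.
apply: (@le_trans _ _ (\sum_(i < n) ((c 1 i)%:E * \int[P]_x (ey 1 i x)%:E
    + (c (-1) i)%:E * \int[P]_x (ey (-1) i x)%:E))%E).
  apply: lee_sum => i _; apply: leeD;
    apply: (@integral_exp_load_le lambda S C alpha) => //; lra.
have -> : (\sum_(i < n) ((c 1 i)%:E * \int[P]_x (ey 1 i x)%:E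
    + (c (-1) i)%:E * \int[P]_x (ey (-1) i x)%:E) =
    \int[P]_x (\sum_(i < n) (c 1 i * ey 1 i x + c (-1) i * ey (-1) i x))%:E)%E.
  transitivity (\int[P]_x \sum_(i < n) ((c 1 i)%:E * (ey 1 i x)%:E
      + (c (-1) i)%:E * (ey (-1) i x)%:E))%E; last first.
    by apply: eq_integral => x _; rewrite -sumEFin.
  have ce0 sg i x : -1 <= sg -> sg <= 1 -> (0 <= (c sg i)%:E * (ey sg i x)%:E)%E.
    by move=> s1 s2; rewrite -EFinM lee_fin mulr_ge0 ?expR_ge0// c0.
  have mce sg i : measurable_fun setT (fun x => (c sg i)%:E * (ey sg i x)%:E)%E.
    by apply: measurable_funeM; exact: mexp.
  rewrite ge0_integral_sum//; first last.
  - by move=> i x _; rewrite adde_ge0// ce0//; lra.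
  - by move=> i; apply: emeasurable_funD.
  apply: eq_bigr => i _; rewrite ge0_integralD//; first last.
  - by move=> x _; rewrite ce0//; lra.
  - by move=> x _; rewrite ce0//; lra.
  rewrite !ge0_integralZl_EFin//; try exact: mexp.
  - by move=> x _; rewrite lee_fin expR_ge0.
  - by apply: c0; lra.
  - by move=> x _; rewrite lee_fin expR_ge0.
  - by apply: c0; lra.
have rho0 : 0 <= 1 - beta * eps * (kap / 12).
  have : beta * eps * (kap / 12) <= 1.
    apply: mulr_ile1; [by rewrite mulr_ge0// ltW|lra| |lra].
    by apply: mulr_ile1 => //; exact: ltW.
  lra.
have G0 x : 0 <= potential R alpha n (y r x).
  by apply: sumr_ge0 => i _; rewrite addr_ge0// expR_ge0.
have mG := measurable_potential alpha r smp.
have D0 : 0 <= beta * eps * (kap + (1 + theta)) * n%:R.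
  apply: mulr_ge0; last exact: ltW.
  apply: mulr_ge0; first by apply: mulr_ge0; exact: ltW.
  by apply: addr_ge0; [exact: ltW|apply: addr_ge0; [|exact: ltW]].
apply: (@le_trans _ _ (\int[P]_x ((1 - beta * eps * (kap / 12))%:E
    * (potential R alpha n (y r x))%:E
    + (beta * eps * (kap + (1 + theta)) * n%:R)%:E))%E).
  apply: ge0_le_integral => //.
  - move=> x _; rewrite lee_fin; apply: sumr_ge0 => i _.
    by rewrite addr_ge0// mulr_ge0 ?expR_ge0// c0//; lra.
  - apply/measurable_EFinP; apply: measurable_sum => i.
    apply: measurable_funD; apply: measurable_funM => //;
      apply: measurableT_comp => //; exact: measurable_funM.
  - by apply: emeasurable_funD => //; apply: measurable_funeM; exact/measurable_EFinP.
  - move=> x _; rewrite -EFinM -EFinD lee_fin.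
    apply: le_trans (@potential_drift R n b r (fun t => w t x) (fun t => a t x)
      delta eps alpha beta K p d0 d1 e0 n0 pp c1 al0 be0 Kb).
    apply: ler_sum => i _; rewrite /c /ey.
    by rewrite !mul1r !mulN1r mulNr.
rewrite ge0_integralD//; first last.
- by apply: measurable_funeM; exact/measurable_EFinP.
- by move=> x _; rewrite -EFinM lee_fin mulr_ge0.
rewrite ge0_integralZl_EFin//; last 2 first.
- by move=> x _; rewrite lee_fin.
- exact/measurable_EFinP.
apply: leeD => //.
have := @integral_cst _ T R P setT measurableT
  (beta * eps * (kap + (1 + theta)) * n%:R)%:E.
by move=> ->; rewrite [X in (_ * X)%E](@probability_setT _ _ _ P) mule1.
Qed.

End expected_potential.

Lemma max_abs_load_le (R : realType) (n : nat) (alpha K : R) (y : n.-tuple R) :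
  0 < alpha -> 1 <= K -> potential R alpha n y < K ->
  max_abs_load y <= ln K / alpha.
Proof.
move=> al0 K1 yK.
(* The default value 0 of the maximum must also lie below the bound; this is where [1 <= K]
   enters. *)
apply: bigmax_le => [|i _]; first by rewrite divr_ge0 ?ln_ge0// ltW.
rewrite ler_pdivlMr// -ler_expR lnK; last by rewrite posrE; lra.
apply: le_trans (ltW yK); rewrite /potential (bigD1 i)//=.
apply: (@le_trans _ _ (expR (alpha * tnth y i) + expR (- (alpha * tnth y i)))).
  have [y0|y0] := leP 0 (tnth y i).
    by rewrite ger0_norm// (mulrC _ alpha) lerDl expR_ge0.
  by rewrite ltr0_norm// mulNr (mulrC _ alpha) lerDr expR_ge0.
by rewrite lerDl sumr_ge0// => j _; rewrite addr_ge0// expR_ge0.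
Qed.

(** The bound is the fixed point of the recursion in [expected_potential_step], the additive term
    divided by [beta * eps * (kap / 12)]; the initial value 2 n lies below it. *)
Lemma expected_potential_le (d : measure_display) (T : measurableType d)
    (R : realType) (P : probability T R) (n b : nat) (p : 'I_n -> R)
    (W : probability R R) (w : nat -> {RV P >-> R}) (a : nat -> T -> 'I_n)
    (delta eps lambda S C alpha : R) (r : nat) :
  let beta := alpha * (b%:R / n%:R) in
  let B0 := S * (C + 1) in
  let theta := delta / (1 - delta) in
  let kap := Num.min 1 theta in
  0 < delta -> delta < 1 -> 0 < eps -> eps < 1 -> (0 < n)%N ->
  prob_vector p -> condC1 delta eps p -> condC2 C p -> weight_law lambda S W ->
  ball_samples p W w a -> (n <= b)%N -> 1 < C -> 1 <= S ->
  0 < alpha -> alpha < Num.min (lambda / 2) 1 ->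
  beta <= 1 -> beta * (C + B0) <= 1 / 2 ->
  (B0 + 2 * (C + B0) ^+ 2) * beta <= kap * eps / 12 ->
  (\int[P]_x (potential R alpha n
      (batch_loads b (fun t => w t x) (fun t => a t x) r))%:E
    <= (12 * (kap + (1 + theta)) / kap * n%:R)%:E)%E.
Proof.
move=> beta B0 theta kap d0 d1 e0 e1 n0 pp c1 pC WL smp nb C1 S1 al0 al1 be1 beC Kb.
have nR : 0 < n%:R :> R by rewrite ltr0n.
have bR : 0 < b%:R :> R by rewrite ltr0n (leq_trans n0).
have be0 : 0 < beta by rewrite mulr_gt0// divr_gt0.
have t0 : 0 < theta by rewrite divr_gt0//; lra.
have kap0 : 0 < kap by rewrite lt_min ltr01.
have kap1 : kap <= 1 by rewrite ge_min lexx.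
elim: r => [|r ih].
  have -> : (\int[P]_x (potential R alpha n
      (batch_loads b (fun t => w t x) (fun t => a t x) 0))%:E = (2 * n%:R)%:E)%E.
    transitivity (\int[P]_x (cst (2 * n%:R)%:E x))%E.
      apply: eq_integral => x _; congr EFin; rewrite /potential.
      under eq_bigr do rewrite tnth_mktuple mulr0 oppr0 expR0.
      by rewrite sumr_const card_ord mulr_natr.
    by rewrite integral_cst// [X in (_ * X)%E](@probability_setT _ _ _ P) mule1.
  rewrite lee_fin ler_pM2r// ler_pdivlMr//.
  move: t0 kap0 kap1; clearbody theta kap; lra.
apply: le_trans (@expected_potential_step _ _ _ P n b p W w a delta eps lambda S C
  alpha r d0 d1 e0 e1 n0 pp c1 pC WL smp nb C1 S1 al0 al1 be1 beC Kb) _.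
rewrite -/theta -/kap -/beta.
have rho0 : 0 <= 1 - beta * eps * (kap / 12).
  have : beta * eps * (kap / 12) <= 1.
    apply: mulr_ile1; [by rewrite mulr_ge0// ltW|lra| |lra].
    by apply: mulr_ile1 => //; exact: ltW.
  lra.
apply: (@le_trans _ _ ((1 - beta * eps * (kap / 12))%:E
  * (12 * (kap + (1 + theta)) / kap * n%:R)%:E
  + (beta * eps * (kap + (1 + theta)) * n%:R)%:E)%E).
  by apply: leeD => //; apply: lee_wpmul2l.
rewrite -EFinM -EFinD lee_fin le_eqVlt; apply/orP; left; apply/eqP.
by clearbody beta theta kap; field; rewrite gt_eqF.
Qed.

(** * Choice of constants and Markov's inequality *)

Theorem theorem4p2 (R : realType) (delta C S lambda : R)
    (delta_gt0 : 0 < delta) (delta_lt1 : delta < 1) (C_gt1 : 1 < C)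
    (S_ge1 : 1 <= S) (lambda_gt0 : 0 < lambda) :
  exists k : R, 0 < k /\
  forall (n b : nat) (eps : R) (p : 'I_n -> R)
    (W : probability R R),
  (n <= b)%N ->
  0 < eps -> eps < 1 ->
  prob_vector p -> condC1 delta eps p -> condC2 C p ->
  weight_law lambda S W ->
  forall (d : measure_display) (T : measurableType d) (P : probability T R)
    (w : nat -> {RV P >-> R}) (a : nat -> T -> 'I_n),
  ball_samples p W w a ->
  forall m : nat, (b %| m)%N ->
  ((1 - n%:R ^- 2)%:E <=
   P [set omega | max_abs_load
                    (batch_loads b (fun t => w t omega) (fun t => a t omega)
                       (m %/ b))
                  <= k * eps^-1 * (b%:R / n%:R) * ln n%:R]%R)%E.
Proof.
pose theta := delta / (1 - delta); pose kap := Num.min 1 theta.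
pose B0 := S * (C + 1); pose Kq := B0 + 2 * (C + B0) ^+ 2.
have t0 : 0 < theta by rewrite divr_gt0//; lra.
have kap0 : 0 < kap by rewrite lt_min ltr01.
have kap1 : kap <= 1 by rewrite ge_min lexx.
have B00 : 0 < B0 by rewrite mulr_gt0//; lra.
have Kq0 : 0 < Kq by rewrite addr_gt0// mulr_gt0// exprn_gt0//; lra.
have mu0 : 0 < Num.min (lambda / 2) 1 by rewrite lt_min ltr01 divr_gt0.
(* With beta = c0 eps, the three terms secure in turn Kq beta <= kap eps / 12, beta (C + B0) <= 1/2,
   and alpha < min (lambda/2, 1). *)
pose c0 := Num.min (kap / (12 * Kq))
             (Num.min (1 / (2 * (C + B0))) (Num.min (lambda / 2) 1)).
have c00 : 0 < c0 by rewrite !lt_min !divr_gt0 ?mulr_gt0//; lra.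
have [c0a c0b c0c] : [/\ c0 <= kap / (12 * Kq), c0 <= 1 / (2 * (C + B0))
    & c0 <= Num.min (lambda / 2) 1].
  split; rewrite /c0 ge_min; first by rewrite lexx.
    by rewrite ge_min lexx orbT.
  by rewrite (ge_min _ (1 / _)) lexx !orbT.
have c01 : c0 <= 1 by apply: le_trans c0c _; rewrite ge_min lexx orbT.
pose K := 12 * (kap + (1 + theta)) / kap.
have K1 : 1 <= K.
  rewrite ler_pdivlMr// mul1r; move: t0 kap0; clearbody theta kap; lra.
have ln20 : 0 < ln 2 :> R by rewrite ln_gt0//; lra.
(* For n >= 2, ln (K n^3) <= (ln K / ln 2 + 3) ln n; the division by [c0] comes from 1 / alpha. *)
exists ((ln K / ln 2 + 3) / c0); split.
  have := ln_ge0 K1 => lnK0.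
  apply: divr_gt0 => //; have : 0 <= ln K / ln 2 by rewrite divr_ge0// ltW.
  lra.
move=> n b eps p W nb e0 e1 pp c1 pC WL d T P w a smp m _.
have n0 : (0 < n)%N.
  case: (posnP n) => // nE; have [_] := pp; rewrite big1 => [|i _].
    by move=> /eqP; rewrite eq_sym oner_eq0.
  by have : (i < 0)%N by rewrite -nE ltn_ord.
(* For n = 1 the claimed probability is 0; the logarithmic estimates below need n >= 2. *)
have [n1|n1] := leqP n 1.
  have -> : (n%:R ^- 2 : R) = 1.
    by have -> : n = 1%N by [apply/eqP; rewrite eqn_leq n1]; rewrite expr1n invr1.
  by rewrite subrr measure_ge0.
have nR : 0 < n%:R :> R by rewrite ltr0n.
have bR : 0 < b%:R :> R by rewrite ltr0n (leq_trans n0).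
(* Chosen so that beta = alpha b / n equals c0 eps; n <= b then gives alpha <= c0 eps < c0. *)
pose alpha := c0 * eps * (n%:R / b%:R).
have beE : alpha * (b%:R / n%:R) = c0 * eps.
  by rewrite /alpha; field; rewrite !gt_eqF.
have al0 : 0 < alpha by rewrite !mulr_gt0// invr_gt0.
have c0e : c0 * eps < c0 by rewrite gtr_pMr.
have alc : alpha <= c0 * eps.
  apply: ler_piMr; first by rewrite mulr_ge0// ltW.
  by rewrite ler_pdivrMr// mul1r ler_nat.
have al1 : alpha < Num.min (lambda / 2) 1.
  exact: le_lt_trans alc (lt_le_trans c0e c0c).
set y := fun x => batch_loads b (fun t => w t x) (fun t => a t x) (m %/ b).
have EG : (\int[P]_x (potential R alpha n (y x))%:E <= (K * n%:R)%:E)%E.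
  apply: (@expected_potential_le _ _ _ P n b p W w a delta eps lambda S C alpha
    (m %/ b)) => //; rewrite beE.
  - exact: le_trans (ltW c0e) c01.
  - move: c0b; rewrite ler_pdivlMr; last by rewrite mulr_gt0//; lra.
    move: c0e c00 B00; rewrite -/B0; clearbody B0 c0; nra.
  - move: c0a; rewrite ler_pdivlMr; last by rewrite mulr_gt0.
    rewrite -/B0 -/Kq -/theta -/kap; clearbody Kq kap c0; nra.
have mG : measurable_fun setT (fun x => potential R alpha n (y x)).
  exact: (measurable_potential _ _ _ _ _ _ _ _ _ _ alpha (m %/ b) smp).
have G0 x : 0 <= potential R alpha n (y x).
  by apply: sumr_ge0 => i _; rewrite addr_ge0// expR_ge0.
(* The expected potential is at most K n, so Markov's inequality at this level leaves exactly
   n^(-2). *)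
pose t := K * n%:R ^+ 3.
have t1 : 1 <= t by rewrite mulr_ege1// exprn_ege1// ler1n.
have t_gt0 : 0 < t by lra.
pose bad := [set x | t <= potential R alpha n (y x)].
have mbad : measurable bad.
  have -> : bad = (fun x => potential R alpha n (y x)) @^-1` `[t, +oo[.
    by apply/seteqP; split => x; rewrite /bad /= in_itv/= andbT.
  by rewrite -[X in measurable X]setTI; exact: mG.
have Pbad : (P bad <= (n%:R ^- 2)%:E)%E.
  have : (t%:E * P bad <= (K * n%:R)%:E)%E.
    apply: le_trans EG.
    have -> : bad = setT `&` [set x | (t%:E <= `|(potential R alpha n (y x))%:E|)%E].
      apply/seteqP; split => x; rewrite /bad /= lee_fin ger0_norm//.
      by case.
    apply: le_trans (@le_integral_comp_abse _ T R P setT measurableT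
      (fun x => (potential R alpha n (y x))%:E) t id _ _ _ _ t_gt0) _ => //.
      exact/measurable_EFinP.
    by under eq_integral do rewrite /= ger0_norm//.
  rewrite -lee_pdivlMl// => /le_trans; apply; rewrite -EFinM lee_fin.
  by rewrite le_eqVlt; apply/orP; left; apply/eqP; rewrite /t; field;
    rewrite !gt_eqF//; lra.
set L := _ * ln n%:R.
have LE : ln t / alpha <= L.
  have lnn : ln 2 <= ln n%:R :> R by rewrite ler_ln ?posrE ?ler_nat// ltr0n.
  rewrite ler_pdivrMr//.
  have -> : L * alpha = (ln K / ln 2 + 3) * ln n%:R.
    by rewrite /L /alpha; field; rewrite !gt_eqF.
  rewrite /t lnM ?posrE ?exprn_gt0//; last lra.
  rewrite lnXn// mulrDl -[_ *+ 3]mulr_natl lerD2r.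
  by rewrite -mulrA ler_peMr ?ln_ge0// mulrC ler_pdivlMr// mul1r.
have L0 : 0 <= L.
  by apply: le_trans LE; apply: divr_ge0; [exact: ln_ge0|exact: ltW].
have good : ~` bad `<=` [set x | max_abs_load (y x) <= L].
  move=> x /negP; rewrite -ltNge => /(max_abs_load_le _ _ _ _ _ al0 t1) h.
  exact: le_trans h LE.
have mgood : measurable [set x | max_abs_load (y x) <= L].
  have -> : [set x | max_abs_load (y x) <= L] =
      \big[setI/setT]_(i < n) ((fun x => `|tnth (y x) i|) @^-1` `]-oo, L]).
    rewrite -bigcap_seq; apply/seteqP; split => x /=.
      move=> h i _; rewrite /= in_itv/=; apply: le_trans h.
      exact: (le_bigmax _ (fun i => `|tnth (y x) i|)).
    move=> h; apply: bigmax_le => // i _.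
    by have := h i (mem_index_enum i); rewrite /= in_itv.
  apply: bigsetI_measurable => i _; rewrite -[X in measurable X]setTI.
  have : measurable_fun setT (fun x => `|tnth (y x) i|).
    apply: measurableT_comp => //.
    exact: (measurable_loads _ _ _ _ _ _ _ _ _ _ (m %/ b) i smp).
  by apply.
apply: le_trans (le_measure P _ _ good); rewrite ?inE//; last exact: measurableC.
have -> : (1 - n%:R ^- 2)%:E = (1 - (n%:R ^- 2)%:E)%E by [].
apply: (@le_trans _ _ (1 - P bad)%E); first exact: leeB.
by rewrite -(probability_setC P mbad).
Qed.
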